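(* Let $\mathcal{R} = \langle \Sigma, \mathcal{I}, \mathcal{T}\rangle$ be a regular transition system, let $Q_I$ and $Q_T$ be the sets of states of $\mathcal{I}$ and $\mathcal{T}$, let $n_T = |Q_T|$, and let $\square\notin Q_T$ be a fresh symbol. There exists an NFA $\mathcal{A}_1$ over $\Sigma$ satisfying the following properties: (1) The states of $\mathcal{A}_1$ are elements of $(Q_T\cup \{\square\})^{n_T} \times (2^{Q_T} \times 2^{Q_T}) \times \{0,1\} \times Q_I$. (2) There is a polynomial-time algorithm (in the size of $\mathcal{R}$) that, given two states $q, q'$ of $\mathcal{A}_1$ and a letter $a \in \Sigma$, decides whether the triple $(q, a, q')$ is a transition of $\mathcal{A}_1$. (3) $L(\mathcal{A}_1) = \mathit{IndInv}_1$.
   Context: All alphabets are finite. For words $w, u \in \Sigma^*$ of the same length $\ell$, $\langle w,u\rangle$ denotes the word $\langle w[1],u[1]\rangle \cdots \langle w[\ell],u[\ell]\rangle \in (\Sigma\times\Sigma)^*$. A (length-preserving) transducer over $\Sigma\times\Sigma$ is an NFA over the alphabet $\Sigma \times \Sigma$. A regular transition system (RTS) is a triple $\langle \Sigma, \mathcal{I}, \mathcal{T}\rangle$ with $\Sigma$ an alphabet, $\mathcal{I}$ an NFA over $\Sigma$, and $\mathcal{T}$ a transducer over $\Sigma\times\Sigma$. Words over $\Sigma$ are configurations; those accepted by $\mathcal{I}$ are initial; $w \leadsto u$ means that $|w|=|u|$ and $\langle w,u\rangle$ is accepted by $\mathcal{T}$. A set $S\subseteq\Sigma^*$ is inductive if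 $w\in S$ and $w\leadsto u$ imply $u\in S$. For $\ell\ge 0$, $\mathit{AP}_\ell$ is the set of atomic propositions $q_{j:\ell}$ with $q\in\Sigma$, $j\in[1,\ell]$. A $1$-formula over $\mathit{AP}_\ell$ is either $\mathit{true}$ or a single clause, i.e. a disjunction of atomic propositions of $\mathit{AP}_\ell$ and constants $\mathit{true},\mathit{false}$ (the empty clause is $\mathit{false}$). A configuration of length $\ell$ satisfies $q_{j:\ell}$ iff its $j$-th letter is $q$, with the usual extension to disjunctions; every configuration of length different from $\ell$ satisfies every formula over $\mathit{AP}_\ell$. A formula is inductive if the set of configurations satisfying it is inductive. For configurations $u,w$, write $u \stackrel{*}{\leadsto}_1 w$ if every inductive $1$-formula (over any $\mathit{AP}_\ell$) satisfied by $u$ is also satisfied by $w$. Let $\mathit{IndInv}_1 = \{w\in\Sigma^*\mid u \stackrel{*}{\leadsto}_1 w \text{ for some initial configuration } u\}$. *)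

(* Defs.v *)
From HB Require Import structures.
From mathcomp Require Import all_boot all_order all_algebra.

Set Implicit Arguments.
Unset Strict Implicit.
Unset Printing Implicit Defensive.

Record nfa (Sigma Q : finType) := NFA {
  nfa_init : {set Q};
  nfa_trans : {set Q * Sigma * Q};
  nfa_final : {set Q}
}.

Fixpoint nfa_accepts_from (Sigma Q : finType) (A : nfa Sigma Q)
    (q : Q) (w : seq Sigma) : bool :=
  if w is a :: w' then
    [exists q', ((q, a, q') \in nfa_trans A) && nfa_accepts_from A q' w']
  else q \in nfa_final A.

Definition nfa_accepts (Sigma Q : finType) (A : nfa Sigma Q) (w : seq Sigma) :=
  [exists q in nfa_init A, nfa_accepts_from A q w].

Record rts := RTS {
  letter : finType;
  stateI : finType;
  stateT : finType;
  autI : nfa letter stateI;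
  autT : nfa (letter * letter)%type stateT
}.

Definition rts_step (R : rts) (w u : seq (letter R)) : Prop :=
  size w = size u /\ nfa_accepts (autT R) (zip w u).

Definition inductive_set (R : rts) (S : seq (letter R) -> Prop) : Prop :=
  forall w u, S w -> rts_step w u -> S u.

(* [Atom q j] is the proposition q_{j+1:l}: positions are counted from 0. *)
Inductive literal (Sigma : Type) (l : nat) :=
  | LTrue
  | LFalse
  | Atom of Sigma & 'I_l.

Inductive formula1 (Sigma : Type) (l : nat) :=
  | FTrue
  | Clause of seq (literal Sigma l).

Definition literal_sat (Sigma : eqType) (l : nat) (w : seq Sigma)
    (x : literal Sigma l) : bool :=
  match x with
  | LTrue => true
  | LFalse => false
  | Atom q j => onth w j == Some q
  end.

Definition formula1_sat (Sigma : eqType) (l : nat) (phi : formula1 Sigma l)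
    (w : seq Sigma) : Prop :=
  size w = l ->
  match phi with
  | FTrue => True
  | Clause c => has (literal_sat w) c
  end.

Definition reach1 (R : rts) (u w : seq (letter R)) : Prop :=
  forall (l : nat) (phi : formula1 (letter R) l),
    inductive_set (formula1_sat phi) -> formula1_sat phi u -> formula1_sat phi w.

Definition IndInv1 (R : rts) (w : seq (letter R)) : Prop :=
  exists u, nfa_accepts (autI R) u /\ reach1 u w.

(* [None] plays the role of the fresh symbol. *)
Definition A1_state (R : rts) : finType :=
  (#|stateT R|.-tuple (option (stateT R))
    * ({set stateT R} * {set stateT R}) * bool * stateI R)%type.

(* A cell contains a bit or is blank ([None]). *)
Definition cell := option bool.

(* A two-way infinite tape: the cells to the left of the head, nearest first,
   and the cells from the head rightwards; all cells not listed are blank. *)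
Definition tape := (seq cell * seq cell)%type.

Inductive move := MoveL | MoveR | Stay.

Definition tape_read (t : tape) : cell := head None t.2.

Definition tape_write (c : cell) (t : tape) : tape := (t.1, c :: behead t.2).

Definition tape_move (m : move) (t : tape) : tape :=
  match m with
  | MoveL => (behead t.1, head None t.1 :: t.2)
  | MoveR => (head None t.2 :: t.1, behead t.2)
  | Stay => t
  end.

(* [tm_halt s] is [Some b] if [s] is a halting state with verdict [b]. *)
Record tm := TM {
  tm_state : finType;
  tm_work : nat;
  tm_start : tm_state;
  tm_halt : tm_state -> option bool;
  tm_delta : tm_state -> {ffun 'I_tm_work.+1 -> cell} ->
    tm_state * ('I_tm_work.+1 -> cell * move)
}.

Definition tm_config (M : tm) := (tm_state M * {ffun 'I_(tm_work M).+1 -> tape})%type.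

Definition tm_init (M : tm) (x : seq bool) : tm_config M :=
  (tm_start M, [ffun i => if i == ord0 then ([::], map some x) else ([::], [::])]).

Definition tm_step (M : tm) (c : tm_config M) : tm_config M :=
  if tm_halt c.1 is Some _ then c else
  let: (s, act) := tm_delta c.1 [ffun i => tape_read (c.2 i)] in
  (s, [ffun i => tape_move (act i).2 (tape_write (act i).1 (c.2 i))]).

(* Halting configurations are fixed by [tm_step], so this says that [M] halts
   on [x] after at most [n] steps, with verdict [b]. *)
Definition tm_decides_within (M : tm) (x : seq bool) (n : nat) (b : bool) :=
  tm_halt (iter n (@tm_step M) (tm_init M x)).1 = Some b.

Definition rts_size (R : rts) : nat :=
  #|letter R| + #|stateI R| + #|stateT R|
  + #|nfa_trans (autI R)| + #|nfa_trans (autT R)|.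

(* Letters and states are named by their rank in the enumeration of their type,
   in unary: the size of a system counts each of them, so this costs only a
   polynomial factor. All the codes below are prefix-free, so concatenation
   encodes pairs. *)
Definition enc_nat (n : nat) : seq bool := rcons (nseq n true) false.

Definition enc_elt (T : finType) (x : T) : seq bool := enc_nat (enum_rank x).

Definition enc_seq (T : Type) (enc : T -> seq bool) (s : seq T) : seq bool :=
  rcons (flatten [seq true :: enc x | x <- s]) false.

Definition enc_option (T : Type) (enc : T -> seq bool) (o : option T) : seq bool :=
  if o is Some x then true :: enc x else [:: false].

Definition enc_set (T : finType) (enc : T -> seq bool) (A : {set T}) : seq bool :=
  enc_seq enc (enum A).

Definition enc_nfa (Sigma Q : finType) (enc : Sigma -> seq bool)
    (A : nfa Sigma Q) : seq bool :=
  enc_set (@enc_elt Q) (nfa_init A)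
  ++ enc_set (fun t => enc_elt t.1.1 ++ enc t.1.2 ++ enc_elt t.2) (nfa_trans A)
  ++ enc_set (@enc_elt Q) (nfa_final A).

Definition enc_rts (R : rts) : seq bool :=
  enc_nat #|letter R| ++ enc_nat #|stateI R| ++ enc_nat #|stateT R|
  ++ enc_nfa (@enc_elt (letter R)) (autI R)
  ++ enc_nfa (fun ab => enc_elt ab.1 ++ enc_elt ab.2) (autT R).

Definition enc_A1_state (R : rts) (q : A1_state R) : seq bool :=
  let: (v, (X, Y), b, p) := q in
  enc_seq (enc_option (@enc_elt (stateT R))) v
  ++ enc_set (@enc_elt (stateT R)) X ++ enc_set (@enc_elt (stateT R)) Y
  ++ [:: b] ++ enc_elt p.

Definition enc_query (R : rts) (q : A1_state R) (a : letter R) (q' : A1_state R) :=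
  enc_rts R ++ enc_A1_state q ++ enc_elt a ++ enc_A1_state q'.

(* Main.v *)
Require Import Defs.
From mathcomp Require Import all_boot all_order all_algebra.
From Stdlib Require Import FunctionalExtensionality.
From mathcomp Require Import zify.
Set Implicit Arguments.
Unset Strict Implicit.
Unset Printing Implicit Defensive.

(** A 1-formula is the complement of a box (a product of sets of letters), and it
    is inductive iff the box is closed under predecessors. Hence [w] is in
    [IndInv1] iff some initial [u] lies in the least predecessor-closed box
    around [w]. That box grows by adding runs of the transducer one after the
    other, and at each boundary between two letters only the order in which the
    states are first visited matters: once a run has passed through a state, its
    left and right halves can be reused by all later runs. The automaton guesses
    this list at every boundary. Between two adjacent boundaries it checks that
    the two lists can be interleaved consistently, which is a least fixed point
    computation over states and letters, and that this produces the guessed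
    letter of [u]. Local consistency suffices, because linear orders that agree
    along a path amalgamate.

    The fixed point is computed by a Turing machine that makes as many passes
    over its input as could possibly be needed, each pass performing monotone
    updates of arrays indexed by ranks in unary. *)

(** * While programs on tapes *)

Section WhilePrograms.

Variable k : nat.

Definition reads := {ffun 'I_k.+1 -> cell}.

(* [None] leaves the scanned cell unchanged. *)
Definition action := 'I_k.+1 -> option cell * move.

Inductive prog :=
  | Do of action
  | Seq of prog & prog
  | If of (reads -> bool) & prog & prog
  | While of (reads -> bool) & prog.

(* Programs never move left of cell [0], so positions can be absolute. *)
Definition mtape := ((nat -> cell) * nat)%type.
Definition memory := 'I_k.+1 -> mtape.

Definition mread (t : mtape) : cell := t.1 t.2.

Definition mwrite (o : option cell) (t : mtape) : mtape :=
  if o is Some c then (fun z => if z == t.2 then c else t.1 z, t.2) else t.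

Definition mmove (v : move) (t : mtape) : mtape :=
  match v with
  | MoveL => (t.1, t.2.-1)
  | MoveR => (t.1, t.2.+1)
  | Stay => t
  end.

Definition mreads (m : memory) : reads := [ffun i => mread (m i)].

Definition mdo (a : action) (m : memory) : memory :=
  fun i => mmove (a i).2 (mwrite (a i).1 (m i)).

(** The step count is exact: an action costs one step and so does every test, as in the compiled
    machine, while sequencing is free. The proviso of [ExecDo] makes the truncated [.-1] in [mmove]
    harmless. *)
Inductive exec : prog -> memory -> nat -> memory -> Prop :=
  | ExecDo a m of (forall i, (a i).2 = MoveL -> 0 < (m i).2) :
      exec (Do a) m 1 (mdo a m)
  | ExecSeq p q m n m1 n' m2 of exec p m n m1 & exec q m1 n' m2 :
      exec (Seq p q) m (n + n') m2
  | ExecIf (c : reads -> bool) p q m n m' of exec (if c (mreads m) then p else q) m n m' :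
      exec (If c p q) m n.+1 m'
  | ExecWhileF (c : reads -> bool) p m of ~~ c (mreads m) : exec (While c p) m 1 m
  | ExecWhileT (c : reads -> bool) p m n m1 n' m2 of c (mreads m) & exec p m n m1
      & exec (While c p) m1 n' m2 :
      exec (While c p) m (n + n').+1 m2.

(** * Compilation of programs into a finite control *)

Fixpoint pc (p : prog) : finType :=
  match p with
  | Do _ => unit
  | Seq p q => (pc p + pc q)%type
  | If _ p q => option (pc p + pc q)
  | While _ p => option (pc p)
  end.

Fixpoint entry (p : prog) : pc p :=
  match p return pc p with
  | Do _ => tt
  | Seq p q => inl (entry p)
  | If _ _ _ => None
  | While _ _ => None
  end.

Definition tapes := {ffun 'I_k.+1 -> tape}.
Definition tm_action := 'I_k.+1 -> cell * move.

Definition idle (r : reads) : tm_action := fun i => (r i, Stay).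

(* The result [None] for the next control point means that the program exits. *)
Fixpoint pstep (p : prog) : pc p -> reads -> option (pc p) * tm_action :=
  match p return pc p -> reads -> option (pc p) * tm_action with
  | Do a => fun _ r => (None, fun i => (odflt (r i) (a i).1, (a i).2))
  | Seq p q => fun s r =>
      match s with
      | inl s =>
          let: (o, act) := pstep s r in
          (Some (if o is Some s' then inl s' else inr (entry q)), act)
      | inr s => let: (o, act) := pstep s r in (omap inr o, act)
      end
  | If c p q => fun s r =>
      match s with
      | None => (Some (Some (if c r then inl (entry p) else inr (entry q))), idle r)
      | Some (inl s) => let: (o, act) := pstep s r in (omap (Some \o inl) o, act)
      | Some (inr s) => let: (o, act) := pstep s r in (omap (Some \o inr) o, act)
      end
  | While c p => fun s r =>
      match s with
      | None => (if c r then Some (Some (entry p)) else None, idle r)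
      | Some s => let: (o, act) := pstep s r in (Some o, act)
      end
  end.

Definition treads (T : tapes) : reads := [ffun i => tape_read (T i)].

Definition tdo (act : tm_action) (T : tapes) : tapes :=
  [ffun i => tape_move (act i).2 (tape_write (act i).1 (T i))].

Inductive steps (p : prog) : pc p -> tapes -> nat -> tapes -> Prop :=
  | StepsExit s T act of pstep s (treads T) = (None, act) :
      steps s T 1 (tdo act T)
  | StepsCont s s' T act n T' of pstep s (treads T) = (Some s', act)
      & steps s' (tdo act T) n T' : steps s T n.+1 T'.

Lemma steps_seq_r p q s T n T' :
  @steps q s T n T' -> @steps (Seq p q) (inr s) T n T'.
Proof.
elim=> {s T n T'} [s T act E|s s' T act n T' E _ IH].
  by apply: StepsExit => /=; rewrite E.
by apply: StepsCont IH; rewrite /= E.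
Qed.

Lemma steps_seq p q s T n T1 n' T2 :
  @steps p s T n T1 -> @steps q (entry q) T1 n' T2 ->
  @steps (Seq p q) (inl s) T (n + n') T2.
Proof.
move=> st1 st2; elim: st1 st2 => {s T n T1} [s T act E|s s' T act n T1 E _ IH] st2.
  by apply: StepsCont (steps_seq_r _ st2); rewrite /= E.
by apply: StepsCont (IH st2); rewrite /= E.
Qed.

Lemma steps_if_l c p q s T n T' :
  @steps p s T n T' -> @steps (If c p q) (Some (inl s)) T n T'.
Proof.
elim=> {s T n T'} [s T act E|s s' T act n T' E _ IH].
  by apply: StepsExit => /=; rewrite E.
by apply: StepsCont IH; rewrite /= E.
Qed.

Lemma steps_if_r c p q s T n T' :
  @steps q s T n T' -> @steps (If c p q) (Some (inr s)) T n T'.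
Proof.
elim=> {s T n T'} [s T act E|s s' T act n T' E _ IH].
  by apply: StepsExit => /=; rewrite E.
by apply: StepsCont IH; rewrite /= E.
Qed.

Lemma steps_while c p s T n T1 n' T2 :
  @steps p s T n T1 -> @steps (While c p) None T1 n' T2 ->
  @steps (While c p) (Some s) T (n + n') T2.
Proof.
move=> st1 st2; elim: st1 st2 => {s T n T1} [s T act E|s s' T act n T1 E _ IH] st2.
  by apply: StepsCont st2; rewrite /= E.
by apply: StepsCont (IH st2); rewrite /= E.
Qed.

(** The left list is compared only with the cells down to [0]; a program never visits what lies
    beyond. *)
Definition tape_of (t : tape) (u : mtape) : Prop :=
  (forall i, nth None t.2 i = u.1 (u.2 + i)) /\
  (forall i, i < u.2 -> nth None t.1 i = u.1 (u.2 - i.+1)).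

Definition tapes_of (T : tapes) (m : memory) := forall i, tape_of (T i) (m i).

Lemma tape_of_read t u : tape_of t u -> tape_read t = mread u.
Proof. by case=> /(_ 0); rewrite nth0 addn0. Qed.

Lemma treads_of T m : tapes_of T m -> treads T = mreads m.
Proof. by move=> Tm; apply/ffunP=> i; rewrite !ffunE (tape_of_read (Tm i)). Qed.

Lemma tape_of_write t u o :
  tape_of t u -> tape_of (tape_write (odflt (mread u) o) t) (mwrite o u).
Proof.
case: u => f h [Hr Hl]; case: o => [c|]; split=> [|] /=.
- case=> [|i] /=; first by rewrite addn0 eqxx.
  by rewrite -[X in _ == X]addn0 eqn_add2l /= nth_behead Hr.
- move=> i ih; rewrite Hl // ifN //=.
  by rewrite neq_ltn ltn_subrL //= (leq_ltn_trans _ ih).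
- by case=> [|i] /=; rewrite ?addn0 // nth_behead Hr.
- exact: Hl.
Qed.

Lemma tape_of_move t u v : (v = MoveL -> 0 < u.2) ->
  tape_of t u -> tape_of (tape_move v t) (mmove v u).
Proof.
case: u => f h; case: v => //= [/(_ erefl) /= h0|_] [/= Hr Hl]; split=> /=.
- case=> [|i] /=; last by rewrite Hr addnS -addSn prednK.
  by rewrite addn0 -nth0 Hl // subn1.
- by move=> i ih; rewrite nth_behead Hl -?ltn_predRL // -subn1 -subnDA.
- by move=> i; rewrite nth_behead Hr addnS.
- case=> [|i] /= ih; first by rewrite -nth0 Hr addn0 subn1.
  by rewrite Hl.
Qed.

Lemma tdo_idle T m : tapes_of T m -> tapes_of (tdo (idle (treads T)) T) m.
Proof.
move=> Tm i; rewrite (treads_of Tm) !ffunE /= ffunE.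
exact: (@tape_of_write _ _ None (Tm i)).
Qed.

Lemma exec_steps p m n m' T : exec p m n m' -> tapes_of T m ->
  exists2 T', @steps p (entry p) T n T' & tapes_of T' m'.
Proof.
move=> ex; elim: ex T => {p m n m'}.
- move=> a m safe T Tm.
  exists (tdo (fun i => (odflt (treads T i) (a i).1, (a i).2)) T).
    exact: StepsExit.
  move=> i; rewrite ffunE /=; apply: tape_of_move => [|].
    by case: (a i).1 (safe i) => [c|] /=.
  by rewrite (treads_of Tm) ffunE; apply: tape_of_write.
- move=> p q m n m1 n' m2 _ IHp _ IHq T /IHp[T1 st1 /IHq[T2 st2 Tm2]].
  by exists T2 => //; apply: steps_seq st1 st2.
- move=> c p q m n m' _ IH T Tm; have [T' st' Tm'] := IH _ (tdo_idle Tm).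
  exists T' => //; case: ifP st' => E st'.
    by apply: (StepsCont _ (steps_if_l c q st')); rewrite /= (treads_of Tm) E.
  by apply: (StepsCont _ (steps_if_r c p st')); rewrite /= (treads_of Tm) E.
- move=> c p m /negbTE E T Tm; exists (tdo (idle (treads T)) T); last exact: tdo_idle.
  by apply: StepsExit; rewrite /= {1}(treads_of Tm) E.
- move=> c p m n m1 n' m2 E _ IH1 _ IH2 T Tm.
  have [T1 st1 /IH2[T2 st2 Tm2]] := IH1 _ (tdo_idle Tm).
  exists T2 => //; apply: StepsCont (steps_while st1 st2).
  by rewrite /= {1}(treads_of Tm) E.
Qed.

(* The extra states read the verdict off the tapes when the program exits. *)
Definition prog_tm (p : prog) (v : reads -> bool) : tm :=
  @TM (pc p + option bool)%type k (inl (entry p))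
    (fun s => if s is inr (Some b) then Some b else None)
    (fun s r => match s with
       | inl s => let: (o, act) := pstep s r in
                  (if o is Some s' then inl s' else inr None, act)
       | inr _ => (inr (Some (v r)), idle r)
       end).

Lemma prog_tm_halt p v n c b :
  tm_halt (iter n (@tm_step (prog_tm p v)) c).1 = Some b ->
  forall n', n <= n' -> tm_halt (iter n' (@tm_step (prog_tm p v)) c).1 = Some b.
Proof.
move=> H n' /subnK <-; elim: (n' - n) => // d IH.
by rewrite addSn iterS /tm_step IH.
Qed.

Lemma prog_tm_steps p v s T n T' : @steps p s T n T' ->
  iter n (@tm_step (prog_tm p v)) (inl s, T) = (inr None, T').
Proof.
elim=> {s T n T'} [s T act E|s s' T act n T' E _ IH].
  rewrite /= /tm_step /=; case Ep: (pstep _ _) => [o act'].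
  by move: Ep; rewrite -/(treads T) E => -[<- <-].
rewrite iterSr -IH; congr iter.
rewrite /tm_step /=; case Ep: (pstep _ _) => [o act'].
by move: Ep; rewrite -/(treads T) E => -[<- <-].
Qed.

(** The origin is placed [h i] blank cells to the left of the initial head, so that a program can
    use these blanks as sentinels without crossing position [0]. *)
Definition input_mem (x : seq bool) (h : 'I_k.+1 -> nat) : memory :=
  fun i => (fun z => nth None (if i == ord0 then nseq (h i) None ++ map some x else [::]) z, h i).

Lemma prog_tm_decides p v x h n m n0 :
  exec p (input_mem x h) n m -> n < n0 ->
  tm_decides_within (prog_tm p v) x n0 (v (mreads m)).
Proof.
move=> ex nn0; have /(exec_steps ex)[T' st Tm] :
    tapes_of (tm_init (prog_tm p v) x).2 (input_mem x h).
  move=> i; rewrite ffunE /input_mem; split=> j /=; case: eqP => _ /=.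
  - by rewrite nth_cat size_nseq ltnNge leq_addr /= addKn.
  - by rewrite !nth_nil.
  - move=> jh; rewrite nth_nil nth_cat size_nseq ltn_subrL (leq_ltn_trans _ jh) //=.
    by rewrite nth_nseq if_same.
  - by rewrite !nth_nil.
apply: prog_tm_halt nn0; rewrite iterS (prog_tm_steps v st).
by rewrite /tm_step /= -/(treads T') (treads_of Tm).
Qed.

End WhilePrograms.

(** * Subroutines of the machine *)

Definition takes k (p : prog k) m n m' := exists2 n', n' <= n & exec p m n' m'.

Lemma takes_exec k (p : prog k) m n m' n1 m1 :
  exec p m n1 m1 -> n1 <= n -> m1 = m' -> takes p m n m'.
Proof. by move=> ex le <-; exists n1. Qed.

Lemma takes_le k (p : prog k) m n m' n' m1 :
  takes p m n' m1 -> n' <= n -> m1 = m' -> takes p m n m'.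
Proof. by case=> n1 le ex le' <-; exists n1 => //; apply: leq_trans le'. Qed.

Lemma takes_seq k (p q : prog k) m n1 m1 n2 m2 n :
  takes p m n1 m1 -> takes q m1 n2 m2 -> n1 + n2 <= n -> takes (Seq p q) m n m2.
Proof.
case=> k1 le1 ex1 [k2 le2 ex2] le; exists (k1 + k2); last exact: ExecSeq ex1 ex2.
by apply: leq_trans le; apply: leq_add.
Qed.

Lemma takes_if k (c : reads k -> bool) (p q : prog k) m n m' :
  takes (if c (mreads m) then p else q) m n m' -> takes (If c p q) m n.+1 m'.
Proof. by case=> k1 le1 ex; exists k1.+1 => //; apply: ExecIf. Qed.

Lemma takes_do k (a : action k) m n m' : (forall i, (a i).2 = MoveL -> 0 < (m i).2) ->
  0 < n -> mdo a m = m' -> takes (Do a) m n m'.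
Proof. by move=> safe n0 <-; exists 1 => //; apply: ExecDo. Qed.

(** Tape layout: the input; the letters in the box; for each of the two lists, its enabled and its
    active states; the states of the initial automaton at the two boundaries; a scratch index; the
    round counter; three flags, telling that the left list is fully active, that the right list is,
    and that a suitable initial letter was found. *)
Notation tIn := (@Ordinal 13 0 isT).
Notation tBox := (@Ordinal 13 1 isT).
Notation tEn1 := (@Ordinal 13 2 isT).
Notation tAc1 := (@Ordinal 13 3 isT).
Notation tEn2 := (@Ordinal 13 4 isT).
Notation tAc2 := (@Ordinal 13 5 isT).
Notation tP1 := (@Ordinal 13 6 isT).
Notation tP2 := (@Ordinal 13 7 isT).
Notation tK := (@Ordinal 13 8 isT).
Notation tC := (@Ordinal 13 9 isT).
Notation tF1 := (@Ordinal 13 10 isT).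
Notation tF2 := (@Ordinal 13 11 isT).
Notation tF3 := (@Ordinal 13 12 isT).

Lemma ord13_ind (P : 'I_13 -> Prop) :
  P tIn -> P tBox -> P tEn1 -> P tAc1 -> P tEn2 -> P tAc2 -> P tP1 -> P tP2 ->
  P tK -> P tC -> P tF1 -> P tF2 -> P tF3 -> forall i, P i.
Proof.
move=> P0 P1 P2 P3 P4 P5 P6 P7 P8 P9 P10 P11 P12 [i lti].
do 13?[case: i lti => [|i] lti; first by rewrite (bool_irrelevance lti isT)].
by [].
Qed.

Notation prog13 := (prog 12).
Notation memory13 := (memory 12).

Definition in1 (r : reads 12) : bool := r tIn == Some true.

Definition shift (J : seq 'I_13) (v : move) : action 12 :=
  fun i => (None, if i \in J then v else Stay).

Definition put (c : cell) (J : seq 'I_13) : action 12 :=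
  fun i => (if i \in J then Some c else None, Stay).

Definition advance : prog13 := Do (shift [:: tIn] MoveR).

(** The first shift skips the home cell, so that heads starting there end on cell [r.+1] after a
    code of [r], where arrays keep the bit of rank [r]. The final [advance] passes the terminating
    [false]. *)
Definition seek (J : seq 'I_13) : prog13 :=
  Seq (Do (shift J MoveR)) (Seq (While in1 (Do (shift (tIn :: J) MoveR))) advance).

Definition rewind (j : 'I_13) : prog13 :=
  While (fun r => r j != Some false) (Do (shift [:: j] MoveL)).

Definition shifted (J : seq 'I_13) (n : nat) (m : memory13) : memory13 :=
  fun i => if i \in J then ((m i).1, (m i).2 + n) else m i.

Lemma mdo_shiftR J m : mdo (shift J MoveR) m = shifted J 1 m.
Proof.
apply: functional_extensionality => i; rewrite /mdo /shift /shifted /=.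
by case: ifP => _ //=; rewrite addn1.
Qed.

Lemma shifted_add J n n' m : shifted J n (shifted J n' m) = shifted J (n' + n) m.
Proof.
apply: functional_extensionality => i; rewrite /shifted.
by case E: (i \in J); rewrite ?E /= ?addnA.
Qed.

Lemma shiftR_safe J (m : memory13) i : (shift J MoveR i).2 = MoveL -> 0 < (m i).2.
Proof. by rewrite /shift /=; case: ifP. Qed.

(* Cell [0] of the input tape is the blank to the left of the input. *)
Definition input (x : seq bool) : nat -> cell :=
  fun z => nth None (None :: map some x) z.

Arguments input : simpl never.

Lemma input_read x h b v : drop h x = b :: v -> input x h.+1 = Some b.
Proof.
by move=> dx; rewrite /input /= -[h]addn0 -nth_drop -map_drop dx.
Qed.

Lemma drop_cat_add (T : Type) (x : seq T) h s v :
  drop h x = s ++ v -> drop (h + size s) x = v.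
Proof. by rewrite addnC -drop_drop => ->; rewrite drop_size_cat. Qed.

Lemma exec_seek_loop J m r x h v : tIn \notin J -> drop h x = enc_nat r ++ v ->
  m tIn = (input x, h.+1) ->
  exec (While in1 (Do (shift (tIn :: J) MoveR))) m (r.*2).+1 (shifted (tIn :: J) r m).
Proof.
move=> inJ; elim: r m h => [|r IH] m h dx mIn.
  have -> : shifted (tIn :: J) 0 m = m.
    apply: functional_extensionality => i; rewrite /shifted.
    by case: ifP => // _; rewrite addn0; case: (m i).
  by apply: ExecWhileF; rewrite /in1 /mreads ffunE mIn /mread /= (input_read dx).
rewrite doubleS; apply: (@ExecWhileT _ _ _ _ 1 (shifted (tIn :: J) 1 m)).
- by rewrite /in1 /mreads ffunE mIn /mread /= (input_read dx).
- by rewrite -mdo_shiftR; apply: ExecDo; apply: shiftR_safe.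
- rewrite -[r.+1]add1n -shifted_add; apply: (IH _ h.+1).
    by rewrite -add1n -drop_drop dx /= drop0.
  by rewrite /shifted /= mIn /= addn1.
Qed.

Definition sought (J : seq 'I_13) (n : nat) (m : memory13) : memory13 :=
  shifted (tIn :: J) n m.

Lemma takes_seek J m r x h v n : tIn \notin J -> drop h x = enc_nat r ++ v ->
  m tIn = (input x, h.+1) -> r.*2 + 3 <= n ->
  takes (seek J) m n (sought J r.+1 m).
Proof.
move=> inJ dx mIn le.
have ex : exec (seek J) m (1 + ((r.*2).+1 + 1))
    (mdo (shift [:: tIn] MoveR) (shifted (tIn :: J) r (mdo (shift J MoveR) m))).
  apply: ExecSeq; first by apply: ExecDo; apply: shiftR_safe.
  apply: ExecSeq; last by apply: ExecDo; apply: shiftR_safe.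
  rewrite mdo_shiftR; apply: exec_seek_loop dx _ => //.
  by rewrite /shifted (negbTE inJ).
apply: takes_exec ex _ _; first lia.
rewrite !mdo_shiftR; apply: functional_extensionality => i.
rewrite /sought /shifted !inE; case: eqP => [->|_] /=.
  by rewrite (negbTE inJ) /= -addnA addn1.
by case E: (i \in J); rewrite ?E //= -addnA.
Qed.

Definition home (f : nat -> cell) := forall z, (f z == Some false) = (z == 0).

Definition rewound (j : 'I_13) (m : memory13) : memory13 :=
  fun i => if i == j then ((m i).1, 0) else m i.

Lemma takes_rewind j (m : memory13) n : home (m j).1 -> (m j).2.*2 < n ->
  takes (rewind j) m n (rewound j m).
Proof.
case E: (m j) => [f h] /= homef le; exists h.*2.+1 => // {le}.
elim: h m E => [|h IH] m E.
  have -> : rewound j m = m.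
    apply: functional_extensionality => i; rewrite /rewound.
    by case: eqP => // ->; rewrite E.
  by apply: ExecWhileF; rewrite /mreads ffunE E /mread /= negbK homef.
pose m1 : memory13 := fun i => if i == j then (f, h) else m i.
have -> : rewound j m = rewound j m1.
  apply: functional_extensionality => i; rewrite /rewound /m1.
  by case: eqP => // ->; rewrite E.
rewrite doubleS; apply: (@ExecWhileT _ _ _ _ 1 m1).
- by rewrite /mreads ffunE E /mread /= homef.
- have -> : m1 = mdo (shift [:: j] MoveL) m.
    apply: functional_extensionality => i; rewrite /m1 /mdo /shift inE /=.
    by case: eqP => [->|_] //=; rewrite E.
  by apply: ExecDo => i; rewrite /shift inE /=; case: eqP => // -> _; rewrite E.
- by apply: IH; rewrite /m1 eqxx.
Qed.

(* The mark stored on [tK] is an index into the array of [tBox]. *)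
Definition transfer : prog13 :=
  While (fun r => r tK != Some false)
    (Do (fun i => (None, if i == tK then MoveL else if i == tBox then MoveR else Stay))).

Definition transferred (m : memory13) : memory13 :=
  fun i => if i == tK then ((m i).1, 0)
           else if i == tBox then ((m i).1, (m i).2 + (m tK).2) else m i.

Lemma takes_transfer (m : memory13) n : home (m tK).1 -> (m tK).2.*2 < n ->
  takes transfer m n (transferred m).
Proof.
case E: (m tK) => [f h] /= homef le; exists h.*2.+1 => // {le}.
elim: h m E => [|h IH] m E.
  have -> : transferred m = m.
    apply: functional_extensionality => i; rewrite /transferred.
    case: eqP => [->|_]; first by rewrite E.
    by case: eqP => // ->; rewrite E addn0; case: (m _).
  by apply: ExecWhileF; rewrite /mreads ffunE E /mread /= negbK homef.
pose m1 : memory13 := fun i => if i == tK then (f, h)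
  else if i == tBox then ((m i).1, (m i).2.+1) else m i.
have -> : transferred m = transferred m1.
  apply: functional_extensionality => i; rewrite /transferred /m1.
  case: eqP => [->|_]; first by rewrite E.
  by case: eqP => // ->; rewrite E /= addSnnS.
rewrite doubleS; apply: (@ExecWhileT _ _ _ _ 1 m1).
- by rewrite /mreads ffunE E /mread /= homef.
- pose a : action 12 := fun i =>
    (None, if i == tK then MoveL else if i == tBox then MoveR else Stay).
  have -> : m1 = mdo a m.
    apply: functional_extensionality => i; rewrite /m1 /mdo /a /=.
    by case: eqP => [->|_] //=; [rewrite E|case: eqP].
  apply: ExecDo => i; rewrite /a /=; case: eqP => [-> _|_]; first by rewrite E.
  by case: eqP.
- by apply: IH; rewrite /m1 eqxx.
Qed.

(** * Subroutines as updates of an abstract state *)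

Section Passes.

Variables A Q P : finType.

Record st := St {
  bx : {set A};
  e1 : {set Q}; a1 : {set Q};
  e2 : {set Q}; a2 : {set Q};
  p1 : {set P}; p2 : {set P};
  f1 : bool; f2 : bool; f3 : bool
}.

(* The bit of [x] is in cell [(enum_rank x).+1]; [Some false] marks the home cell. *)
Definition array (T : finType) (X : {set T}) : nat -> cell := fun z =>
  if z is z'.+1 then
    if [exists x in X, enum_rank x == z' :> nat] then Some true else None
  else Some false.

Definition flag (b : bool) : nat -> cell :=
  fun z => if (z == 0) && b then Some true else None.

Arguments array : simpl never.
Arguments flag : simpl never.

Lemma home_array (T : finType) (X : {set T}) : home (array X).
Proof. by case=> //= z; rewrite /array; case: ifP. Qed.

Lemma home_put f z0 : home f ->
  home (fun z => if z == z0.+1 then Some true else f z).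
Proof. by move=> homef z; case E: (z == z0.+1); first rewrite (eqP E). Qed.

Lemma array_rank (T : finType) (X : {set T}) x :
  array X (enum_rank x).+1 = if x \in X then Some true else None.
Proof.
rewrite /array; congr (if _ then _ else _); apply/existsP/idP => [[y]|xX].
  by case/andP=> yX /eqP/val_inj/enum_rank_inj <-.
by exists x; rewrite xX eqxx.
Qed.

Lemma array_put (T : finType) (X : {set T}) x :
  (fun z => if z == (enum_rank x).+1 then Some true else array X z) = array (x |: X).
Proof.
apply: functional_extensionality => -[|z] //; rewrite /array eqSS.
case: eqP => [->|zx].
  by rewrite ifT //; apply/existsP; exists x; rewrite setU11 eqxx.
congr (if _ then _ else _); apply/existsP/existsP => -[y /andP[yX /eqP yz]].
  by exists y; rewrite setU1r //= yz.
case/setU1P: yX => [yx|yX]; first by case: zx; rewrite -yz yx.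
by exists y; rewrite yX; apply/eqP.
Qed.

Lemma flag_put (b b' : bool) :
  (fun z => if z == 0 then if b then Some true else None else flag b' z) = flag b.
Proof. by apply: functional_extensionality => -[|z] //; rewrite /flag /= andbF. Qed.

Lemma some_true_if (b : bool) : ((if b then Some true else None) == Some true) = b.
Proof. by case: b. Qed.

Definition mk (x : seq bool) (c : mtape) (s : st) (h : nat) : memory13 := fun i =>
  match val i with
  | 0 => (input x, h.+1)
  | 1 => (array (bx s), 0)
  | 2 => (array (e1 s), 0)
  | 3 => (array (a1 s), 0)
  | 4 => (array (e2 s), 0)
  | 5 => (array (a2 s), 0)
  | 6 => (array (p1 s), 0)
  | 7 => (array (p2 s), 0)
  | 8 => (array (@set0 A), 0)
  | 9 => c
  | 10 => (flag (f1 s), 0)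
  | 11 => (flag (f2 s), 0)
  | _ => (flag (f3 s), 0)
  end.

(* Every subroutine spends at most 40 steps per bit that it reads. *)
Definition consumes (p : prog13) (seg : seq bool) (s s' : st) :=
  forall x c h v, drop h x = seg ++ v ->
  takes p (mk x c s h) (40 * size seg) (mk x c s' (h + size seg)).

Lemma consumes_seq p q u v s s1 s2 :
  consumes p u s s1 -> consumes q v s1 s2 -> consumes (Seq p q) (u ++ v) s s2.
Proof.
move=> cp cq x c h w; rewrite -catA => dx.
rewrite size_cat addnA; apply: takes_seq (cp _ _ _ _ dx) (cq _ _ _ _ _) _.
  exact: drop_cat_add dx.
by rewrite mulnDr.
Qed.

Lemma size_enc_nat r : size (enc_nat r) = r.+1.
Proof. by rewrite size_rcons size_nseq. Qed.

Lemma exec_advance x c s h : exec advance (mk x c s h) 1 (mk x c s (h + 1)).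
Proof.
have -> : mk x c s (h + 1) = mdo (shift [:: tIn] MoveR) (mk x c s h).
  apply: functional_extensionality => i; elim/ord13_ind: i => //=.
  by rewrite /mdo /= /mk /= addn1.
by apply: ExecDo; apply: shiftR_safe.
Qed.

Lemma consumes_bit b s : consumes advance [:: b] s s.
Proof. by move=> x c h v dx; exists 1 => //; apply: exec_advance. Qed.

Lemma consumes_skip r s : consumes (seek [::]) (enc_nat r) s s.
Proof.
move=> x c h v dx; rewrite size_enc_nat.
apply: takes_le (takes_seek _ dx _ (leqnn _)) _ _ => //; first lia.
by apply: functional_extensionality => i; elim/ord13_ind: i.
Qed.

(** In [enc_seq] a [true] announces an element and a [false] ends the list, so the bit under the
    head decides whether the loop continues. *)
Definition each (body : prog13) : prog13 :=
  Seq (While in1 (Seq advance body)) advance.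

Lemma consumes_each (T : eqType) (enc : T -> seq bool) body (g : st -> T -> st) l s :
  (forall t s, t \in l -> consumes body (enc t) s (g s t)) ->
  consumes (each body) (enc_seq enc l) s (foldl g s l).
Proof.
move=> cb x c h v; rewrite /enc_seq -cats1 -catA => dx.
have {}dx : drop h x = flatten [seq true :: enc t | t <- l] ++ false :: v by [].
rewrite size_cat /= addnA; set S := size (flatten _).
apply: (@takes_seq _ _ _ _ (40 * S).+1 (mk x c (foldl g s l) (h + S)) 39); last lia.
  rewrite {}/S; elim: l s h cb dx => [|t l IH] s h cb dx.
    exists 1 => //; rewrite addn0; apply: ExecWhileF.
    by rewrite /in1 /mreads ffunE /mread /= (input_read dx).
  have dt : drop (h + 1) x = enc t ++ flatten [seq true :: enc t | t <- l] ++ false :: v.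
    by rewrite addn1 -add1n -drop_drop dx /= drop0 catA.
  have [n2 le2 ex2] := cb t s (mem_head _ _) x c (h + 1) _ dt.
  have cb' u s' : u \in l -> consumes body (enc u) s' (g s' u).
    by move=> lu; apply: cb; rewrite inE lu orbT.
  have [n3 le3 ex3] := IH (g s t) _ cb' (drop_cat_add dt).
  exists (1 + n2 + n3).+1.
    by move: le2 le3; rewrite /= size_cat; lia.
  apply: (ExecWhileT _ (ExecSeq (exec_advance x c s h) ex2)).
    by rewrite /in1 /mreads ffunE /mread /= (input_read dx).
  rewrite (_ : h + size _ = h + 1 + size (enc t)
      + size (flatten [seq true :: enc u | u <- l])) //.
  by rewrite /= size_cat; lia.
by exists 1 => //; apply: exec_advance.
Qed.

Definition skip : prog13 := Do (put None [::]).

Lemma takes_put c J (m : memory13) n : 0 < n -> takes (Do (put c J)) m n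
  (fun i => if i \in J then (fun z => if z == (m i).2 then c else (m i).1 z, (m i).2)
            else m i).
Proof.
move=> n0; apply: takes_do => //.
by apply: functional_extensionality => i; rewrite /mdo /put /=; case: ifP.
Qed.

Lemma takes_skip (m : memory13) n : 0 < n -> takes skip m n m.
Proof. by move=> n0; apply: takes_do => //; apply: functional_extensionality. Qed.

Definition insert_at (j : 'I_13) : prog13 :=
  Seq (seek [:: j]) (Seq (Do (put (Some true) [:: j])) (rewind j)).

Lemma takes_insert_at (T : finType) j x h v (t : T) (X : {set T}) m :
  j != tIn -> drop h x = enc_elt t ++ v -> m tIn = (input x, h.+1) ->
  m j = (array X, 0) ->
  takes (insert_at j) m (40 * size (enc_elt t))
    (fun i => if i == tIn then (input x, (h + size (enc_elt t)).+1)
              else if i == j then (array (t |: X), 0) else m i).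
Proof.
move=> jIn dx mIn mj; rewrite /enc_elt size_enc_nat.
apply: takes_seq (takes_seek _ dx mIn (leqnn _)) _ _; first by rewrite inE eq_sym.
  apply: takes_seq (takes_put _ _ _ (leqnn 1)) _ (leqnn _).
  apply: takes_le (takes_rewind _ (leqnn _)) (leqnn _) _.
    rewrite /= !inE eqxx /sought /shifted !inE eqxx orbT mj /=.
    exact/home_put/home_array.
  apply: functional_extensionality => i.
  rewrite /rewound /sought /shifted !inE; case: (i =P j) => [->|_] /=.
    by rewrite orbT mj /= (negbTE jIn) array_put.
  by rewrite orbF; case: eqP => // ->; rewrite mIn /= addSn.
rewrite /= !inE eqxx /sought /shifted !inE eqxx orbT mj /=; lia.
Qed.

Fixpoint rewinds (J : seq 'I_13) : prog13 :=
  if J is j :: J' then Seq (rewind j) (rewinds J') else skip.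

Definition all_rewound (J : seq 'I_13) (m : memory13) : memory13 :=
  fun i => if i \in J then ((m i).1, 0) else m i.

Lemma takes_rewinds J (m : memory13) N :
  (forall j, j \in J -> home (m j).1 /\ (m j).2 <= N) ->
  takes (rewinds J) m (size J * N.*2.+1).+1 (all_rewound J m).
Proof.
elim: J m => [|j J IH] m mJ /=; first exact: takes_skip.
have [homej lej] := mJ j (mem_head _ _).
apply: takes_seq (takes_rewind homej (_ : _ < N.*2.+1)) _ _; first lia.
  apply: takes_le (IH _ _) (leqnn _) _ => [i iJ|].
    rewrite /rewound; case: eqP => [->|_]; first by split.
    by apply: mJ; rewrite inE iJ orbT.
  apply: functional_extensionality => i; rewrite /all_rewound /rewound inE.
  by case: (i == j) => //=; case: ifP.
by rewrite mulSn addnS.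
Qed.

Definition test_I : prog13 :=
  Seq (seek [:: tP1]) (Seq (seek [:: tBox]) (Seq (seek [:: tP2])
  (Seq (If (fun r => [&& r tP1 == Some true, r tBox == Some true & r tP2 == Some true])
         (Do (put (Some true) [:: tF3])) skip)
  (rewinds [:: tP1; tBox; tP2])))).

Definition step_I (s : st) (t : P * A * P) : st :=
  let: St bx e1 a1 e2 a2 p1 p2 f1 f2 f3 := s in
  St bx e1 a1 e2 a2 p1 p2 f1 f2
    (f3 || [&& t.1.1 \in p1, t.1.2 \in bx & t.2 \in p2]).

Lemma consumes_test_I s (t : P * A * P) :
  consumes test_I (enc_elt t.1.1 ++ enc_elt t.1.2 ++ enc_elt t.2) s (step_I s t).
Proof.
case: t => [[q a] q']; case: s => bx e1 a1 e2 a2 p1 p2 f1 f2 f3 x c h v /=.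
rewrite /enc_elt -!catA => dx; rewrite !size_cat !size_enc_nat.
have dx1 := drop_cat_add dx; have dx2 := drop_cat_add dx1.
rewrite !size_enc_nat in dx1 dx2.
apply: takes_seq (takes_seek _ dx _ (leqnn _)) _ _ => //.
apply: takes_seq (takes_seek _ dx1 _ (leqnn _)) _ (leqnn _) => //.
apply: takes_seq (takes_seek _ dx2 _ (leqnn _)) _ (leqnn _) => //.
set M := sought _ _ _.
have MP1 : M tP1 = (array p1, (enum_rank q).+1) by [].
have MBox : M tBox = (array bx, (enum_rank a).+1) by [].
have MP2 : M tP2 = (array p2, (enum_rank q').+1) by [].
pose M' : memory13 := fun i => if i == tF3 then
  (flag (f3 || [&& q \in p1, a \in bx & q' \in p2]), 0) else M i.
apply: (takes_seq (_ : takes _ _ 2 M') _ (leqnn _)).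
  apply: takes_if.
  rewrite /mreads !ffunE MP1 MBox MP2 /mread /= !array_rank !some_true_if.
  case: ifP => E; last first.
    apply: takes_le (takes_skip _ (leqnn 1)) _ _ => //.
    apply: functional_extensionality => i; rewrite /M' E orbF.
    by case: eqP => // ->.
  apply: takes_le (takes_put _ _ _ (leqnn 1)) _ _ => //.
  apply: functional_extensionality => i; rewrite /M' E orbT inE.
  by case: eqP => // ->; rewrite -(flag_put true f3).
apply: takes_le (@takes_rewinds _ _ (enum_rank q + enum_rank a + enum_rank q').+1 _) (leqnn _) _.
  by move=> j; rewrite !inE => /or3P[] /eqP ->; split; rewrite /M' ?MP1 ?MBox ?MP2 /=;
    try exact: home_array; lia.
apply: functional_extensionality; elim/ord13_ind => //.
  by rewrite /all_rewound /M' /M /sought /shifted /mk /=; congr (_, _); lia.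
rewrite /=; lia.
Qed.

(** The head of [tBox] must be on the second letter for the test and on the first one for the
    insertion, but the first is read earlier. Its rank is kept as a head position on [tK] and
    transferred after the test. *)
Definition test_T : prog13 :=
  Seq (seek [:: tEn1; tAc1]) (Seq (seek [:: tK]) (Seq (seek [:: tBox])
  (Seq (seek [:: tEn2; tAc2])
  (Seq (If (fun r => [&& r tEn1 == Some true, r tBox == Some true & r tEn2 == Some true])
         (Seq (Do (put (Some true) [:: tAc1; tAc2]))
         (Seq (rewind tBox) (Seq transfer (Do (put (Some true) [:: tBox])))))
         skip)
  (rewinds [:: tEn1; tAc1; tK; tBox; tEn2; tAc2]))))).

(** One step of the backward closure: a transition whose target letter is in the box and whose end
    states are both enabled adds its source letter and activates both states. *)
Definition step_T (s : st) (t : Q * (A * A) * Q) : st :=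
  if [&& t.1.1 \in e1 s, t.1.2.2 \in bx s & t.2 \in e2 s] then
    St (t.1.2.1 |: bx s) (e1 s) (t.1.1 |: a1 s) (e2 s) (t.2 |: a2 s)
       (p1 s) (p2 s) (f1 s) (f2 s) (f3 s)
  else s.

Lemma consumes_test_T s (t : Q * (A * A) * Q) :
  consumes test_T
    (enc_elt t.1.1 ++ (enc_elt t.1.2.1 ++ enc_elt t.1.2.2) ++ enc_elt t.2)
    s (step_T s t).
Proof.
case: t => [[q [a b]] q'] x c h v; rewrite /enc_elt -!catA /= => dx.
rewrite !size_cat !size_enc_nat.
have dx1 := drop_cat_add dx; have dx2 := drop_cat_add dx1.
have dx3 := drop_cat_add dx2; rewrite !size_enc_nat in dx1 dx2 dx3.
apply: takes_seq (takes_seek _ dx _ (leqnn _)) _ _ => //.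
apply: takes_seq (takes_seek _ dx1 _ (leqnn _)) _ (leqnn _) => //.
apply: takes_seq (takes_seek _ dx2 _ (leqnn _)) _ (leqnn _) => //.
apply: takes_seq (takes_seek _ dx3 _ (leqnn _)) _ (leqnn _) => //.
set M := sought _ _ _.
have ME1 : M tEn1 = (array (e1 s), (enum_rank q).+1) by [].
have MA1 : M tAc1 = (array (a1 s), (enum_rank q).+1) by [].
have MK : M tK = (array (@set0 A), (enum_rank a).+1) by [].
have MBox : M tBox = (array (bx s), (enum_rank b).+1) by [].
have ME2 : M tEn2 = (array (e2 s), (enum_rank q').+1) by [].
have MA2 : M tAc2 = (array (a2 s), (enum_rank q').+1) by [].
pose M1 : memory13 := fun i =>
  if i == tAc1 then (array (q |: a1 s), (enum_rank q).+1)
  else if i == tAc2 then (array (q' |: a2 s), (enum_rank q').+1)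
  else if i == tK then (array (@set0 A), 0)
  else if i == tBox then (array (a |: bx s), (enum_rank a).+1) else M i.
pose M' := if [&& q \in e1 s, b \in bx s & q' \in e2 s] then M1 else M.
pose N := (enum_rank q + enum_rank a + enum_rank b + enum_rank q').+1.
apply: (takes_seq (_ : takes _ _ (4 * N + 9).+1 M') _ (leqnn _)).
  apply: takes_if.
  rewrite /mreads !ffunE ME1 MBox ME2 /mread /= !array_rank !some_true_if /M'.
  case: ifP => E; last by apply: takes_skip.
  apply: takes_seq (takes_put _ _ _ (leqnn 1)) _ _.
    apply: takes_seq (takes_rewind _ (leqnn _)) _ (leqnn _); first exact: home_array.
    apply: takes_seq (takes_transfer _ (leqnn _)) _ (leqnn _); first exact: home_array.
    apply: takes_le (takes_put _ _ _ (leqnn 1)) (leqnn _) _.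
    apply: functional_extensionality; elim/ord13_ind => //.
    - by rewrite /transferred /rewound /M1 /= -array_put.
    - by rewrite /transferred /rewound /M1 /= -array_put.
    - by rewrite /transferred /rewound /M1 /= -array_put.
  rewrite /N /transferred /rewound /=; lia.
apply: takes_le (@takes_rewinds _ _ N _) (leqnn _) _.
  move=> j; rewrite !inE /M'; case: ifP => E.
    by do 5?[case/predU1P=> [->|]]; try move/eqP=> ->; split;
      rewrite /N /M1 ?ME1 ?ME2 ?MA1 ?MA2 ?MBox ?MK /=; try exact: home_array; lia.
  by do 5?[case/predU1P=> [->|]]; try move/eqP=> ->; split;
    rewrite /N ?ME1 ?ME2 ?MA1 ?MA2 ?MBox ?MK /=; try exact: home_array; lia.
rewrite /step_T /M' /=; case: ifP => E; apply: functional_extensionality;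
  elim/ord13_ind => //;
  by rewrite /all_rewound /M1 /M /sought /shifted /mk /=; congr (_, _); lia.
rewrite /=; lia.
Qed.

(** The flag [F] records that all earlier states of the list are active. While it is up, the state
    being read becomes enabled; it falls at the first inactive state. So the states that get enabled
    are those of [front], and the final flag tells whether the whole list is active. *)
Definition scan (E Ac F : 'I_13) : prog13 :=
  If in1
    (Seq advance
      (If (fun r => r F == Some true)
         (Seq (seek [:: E; Ac]) (Seq (Do (put (Some true) [:: E]))
         (Seq (If (fun r => r Ac == Some true) skip (Do (put None [:: F])))
         (rewinds [:: E; Ac]))))
         (seek [::])))
    advance.

Definition scanned E F (f' : bool) (X : {set Q}) x h (m : memory13) : memory13 := fun i =>
  if i == tIn then (input x, h.+1) else if i == E then (array X, 0)
  else if i == F then (flag f', 0) else m i.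

Lemma takes_scan E Ac F (m : memory13) x h v (q : Q) X Y f :
  uniq [:: tIn; E; Ac; F] -> drop h x = enc_option (@enc_elt Q) (Some q) ++ v ->
  m tIn = (input x, h.+1) -> m E = (array X, 0) -> m Ac = (array Y, 0) ->
  m F = (flag f, 0) ->
  takes (scan E Ac F) m (40 * size (enc_option (@enc_elt Q) (Some q)))
    (scanned E F (f && (q \in Y)) (if f then q |: X else X) x
       (h + size (enc_option (@enc_elt Q) (Some q))) m).
Proof.
rewrite [uniq _]/= !inE !negb_or -!andbA.
case/and5P=> inE_ inA inF EA /and3P[EF AF _] dx mIn mE mA mF.
have [r [Er arP arR]] : exists r, [/\ enc_option (@enc_elt Q) (Some q) = true :: enc_nat r,
    (fun z => if z == r.+1 then Some true else array X z) = array (q |: X)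
    & array Y r.+1 = if q \in Y then Some true else None].
  by exists (enum_rank q); split=> //; [apply: array_put|apply: array_rank].
rewrite {}Er in dx *; rewrite /= size_enc_nat.
have EIn := inE_; have AIn := inA; have FIn := inF.
rewrite eq_sym in EIn; rewrite eq_sym in AIn; rewrite eq_sym in FIn.
have AE := EA; have FE := EF; have FA := AF.
rewrite eq_sym in AE; rewrite eq_sym in FE; rewrite eq_sym in FA.
pose m1 : memory13 := fun i => if i == tIn then (input x, h.+2) else m i.
apply: (@takes_le _ _ _ _ _ (1 + (30 * r.+1 + 8).+1).+1 _); [|by clear; lia|exact: erefl].
apply: takes_if; rewrite {1}/in1 /mreads ffunE mIn /mread /= (input_read dx) eqxx.
apply: (takes_seq (_ : takes _ _ 1 m1) _ (leqnn _)).
  apply: takes_do => //; first exact: shiftR_safe.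
  rewrite mdo_shiftR; apply: functional_extensionality => i; rewrite /shifted /m1 inE.
  by case: eqP => // ->; rewrite mIn addn1.
have dx1 : drop h.+1 x = enc_nat r ++ v.
  by rewrite -add1n -drop_drop dx /= drop0.
have m1In : m1 tIn = (input x, h.+2) by [].
apply: takes_if.
rewrite {1}/mreads ffunE {1}/m1 (negbTE FIn) mF /mread /=.
rewrite {1}/flag eqxx some_true_if.
case: f mF => mF /=; last first.
  apply: takes_le (takes_seek _ dx1 m1In (leqnn _)) _ _ => //.
    clear; lia.
  apply: functional_extensionality => i.
  rewrite /sought /shifted /scanned /m1 !inE; case: (i =P tIn) => _ /=.
    by congr (_, _); clear; lia.
  case: (i =P E) => [->|_]; first by rewrite mE.
  by case: (i =P F) => [->|_]; first by rewrite mF.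
pose rq := r.+1.
pose m2 : memory13 := fun i => if i == tIn then (input x, h.+1 + rq.+1)
  else if i == E then (array (q |: X), rq) else if i == Ac then (array Y, rq) else m i.
apply: takes_seq (takes_seek _ dx1 m1In (leqnn _)) _ _.
- by rewrite !inE negb_or inE_.
- apply: (takes_seq (_ : takes _ _ 1 m2) _ (leqnn _)).
    apply: takes_le (takes_put _ _ _ (leqnn 1)) (leqnn _) _.
    apply: functional_extensionality => i; rewrite /sought /shifted /m2 /m1 !inE.
    case: (i =P E) => [->|_] /=.
      by rewrite (negbTE EIn) mE /= arP.
    case: (i =P tIn) => [->|_] /=; first by congr (_, _); rewrite /rq; clear; lia.
    by case: eqP => // ->; rewrite mA.
  pose m3 : memory13 := fun i => if i == F then (flag (q \in Y), 0) else m2 i.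
  apply: (takes_seq (_ : takes _ _ 2 m3) _ (leqnn _)).
    apply: takes_if; rewrite {1}/mreads ffunE {1}/m2 (negbTE AIn) (negbTE AE) eqxx.
    rewrite /mread /rq /= arR some_true_if.
    have m2F : m2 F = (flag true, 0).
      by rewrite /m2 (negbTE FIn) (negbTE FE) (negbTE FA) mF.
    case: ifP => qY.
      apply: takes_le (takes_skip _ (leqnn 1)) _ _ => //.
      apply: functional_extensionality => i; rewrite /m3 qY.
      by case: eqP => // ->.
    apply: takes_le (takes_put _ _ _ (leqnn 1)) _ _ => //.
    apply: functional_extensionality => i; rewrite /m3 qY inE.
    by case: eqP => // ->; rewrite m2F /= (flag_put false).
  apply: takes_le (@takes_rewinds [:: E; Ac] _ rq _) (leqnn _) _.
    move=> i; rewrite !inE => /orP[] /eqP->.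
      by rewrite /m3 /m2 (negbTE EF) (negbTE EIn) eqxx; split=> //; apply: home_array.
    by rewrite /m3 /m2 (negbTE AF) (negbTE AIn) (negbTE AE) eqxx; split=> //;
      apply: home_array.
  apply: functional_extensionality => i; rewrite /all_rewound /scanned /m3 /m2 !inE.
  case: (i =P E) => [->|_] /=; first by rewrite (negbTE EF) (negbTE EIn).
  case: (i =P Ac) => [->|_] /=; first by rewrite (negbTE AF) (negbTE AIn) mA.
  case: (i =P F) => [->|_]; first by rewrite (negbTE FIn).
  by case: eqP => // _; congr (_, _); rewrite /rq; clear; lia.
- rewrite /=; clear; lia.
Qed.

Lemma takes_scan_none E Ac F x c s h v :
  drop h x = false :: v ->
  takes (scan E Ac F) (mk x c s h) 40 (mk x c s (h + 1)).
Proof.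
move=> dx; apply: takes_le (takes_if (_ : takes _ _ 1 (mk x c s (h + 1)))) _ _ => //.
rewrite {1}/in1 /mreads ffunE /mread /= (input_read dx) /=.
by exists 1 => //; apply: exec_advance.
Qed.

Definition step_S1 (s : st) (o : option Q) : st :=
  if o is Some q then
    St (bx s) (if f1 s then q |: e1 s else e1 s) (a1 s) (e2 s) (a2 s) (p1 s) (p2 s)
      (f1 s && (q \in a1 s)) (f2 s) (f3 s)
  else s.

Definition step_S2 (s : st) (o : option Q) : st :=
  if o is Some q then
    St (bx s) (e1 s) (a1 s) (if f2 s then q |: e2 s else e2 s) (a2 s) (p1 s) (p2 s)
      (f1 s) (f2 s && (q \in a2 s)) (f3 s)
  else s.

Lemma consumes_scan1 s o :
  consumes (scan tEn1 tAc1 tF1) (enc_option (@enc_elt Q) o) s (step_S1 s o).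
Proof.
case: o => [q|] x c h v dx; last exact: takes_scan_none dx.
apply: (takes_le (takes_scan _ dx (erefl _) (erefl _) (erefl _) (erefl _))) => //.
by apply: functional_extensionality; elim/ord13_ind.
Qed.

Lemma consumes_scan2 s o :
  consumes (scan tEn2 tAc2 tF2) (enc_option (@enc_elt Q) o) s (step_S2 s o).
Proof.
case: o => [q|] x c h v dx; last exact: takes_scan_none dx.
apply: (takes_le (takes_scan _ dx (erefl _) (erefl _) (erefl _) (erefl _))) => //.
by apply: functional_extensionality; elim/ord13_ind.
Qed.

Definition add_bx (s : st) a :=
  St (a |: bx s) (e1 s) (a1 s) (e2 s) (a2 s) (p1 s) (p2 s) (f1 s) (f2 s) (f3 s).
Definition add_p1 (s : st) p :=
  St (bx s) (e1 s) (a1 s) (e2 s) (a2 s) (p |: p1 s) (p2 s) (f1 s) (f2 s) (f3 s).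
Definition add_p2 (s : st) p :=
  St (bx s) (e1 s) (a1 s) (e2 s) (a2 s) (p1 s) (p |: p2 s) (f1 s) (f2 s) (f3 s).

Lemma consumes_add_bx s a : consumes (insert_at tBox) (enc_elt a) s (add_bx s a).
Proof.
move=> x c h v dx.
apply: (takes_le (takes_insert_at _ dx (erefl _) (erefl _))) => //.
by apply: functional_extensionality; elim/ord13_ind.
Qed.

Lemma consumes_add_p1 s p : consumes (insert_at tP1) (enc_elt p) s (add_p1 s p).
Proof.
move=> x c h v dx.
apply: (takes_le (takes_insert_at _ dx (erefl _) (erefl _))) => //.
by apply: functional_extensionality; elim/ord13_ind.
Qed.

Lemma consumes_add_p2 s p : consumes (insert_at tP2) (enc_elt p) s (add_p2 s p).
Proof.
move=> x c h v dx.
apply: (takes_le (takes_insert_at _ dx (erefl _) (erefl _))) => //.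
by apply: functional_extensionality; elim/ord13_ind.
Qed.

End Passes.

(** * The machine *)

(** The order follows the layout of [enc_query]. [drop3] skips the three constant bits of a state:
    two empty sets and the bit [false]. *)
Definition pass_prog : prog13 :=
  let skips := each (seek [::]) in
  let drop3 p := Seq advance (Seq advance (Seq advance p)) in
  Seq (seek [::]) (Seq (seek [::]) (Seq (seek [::])
  (Seq skips (Seq (each test_I) (Seq skips
  (Seq skips (Seq (each test_T) (Seq skips
  (Seq (each (scan tEn1 tAc1 tF1)) (drop3 (Seq (insert_at tP1)
  (Seq (insert_at tBox)
  (Seq (each (scan tEn2 tAc2 tF2)) (drop3 (insert_at tP2))))))))))))))).

Definition rewind_input : prog13 :=
  Seq (Do (shift [:: tIn] MoveL))
    (Seq (While (fun r => r tIn != None) (Do (shift [:: tIn] MoveL))) advance).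

(* Writes two marks on [tC] for each bit of the input: one per round to come. *)
Definition copy_input : prog13 :=
  While (fun r => r tIn != None)
    (Seq (Do (fun i => if i == tC then (Some (Some true), MoveR) else (None, Stay)))
         (Do (fun i => if i == tC then (Some (Some true), MoveR)
                       else if i == tIn then (None, MoveR) else (None, Stay)))).

(** The flags [tF1] and [tF2] are raised in every round because scans only lower them, whereas [tF3]
    and the arrays accumulate. The head of [tC] passes one mark per round. *)
Definition main_prog : prog13 :=
  Seq (Do (put (Some false) [:: tBox; tEn1; tAc1; tEn2; tAc2; tP1; tP2; tK]))
  (Seq copy_input (Seq rewind_input (Seq (Do (shift [:: tC] MoveL))
    (While (fun r => r tC == Some true)
      (Seq (Do (put (Some true) [:: tF1; tF2]))
      (Seq pass_prog (Seq rewind_input (Do (shift [:: tC] MoveL))))))))).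

Definition verdict (r : reads 12) : bool :=
  [&& r tF1 == Some true, r tF2 == Some true & r tF3 == Some true].

Definition main_tm : tm := prog_tm main_prog verdict.

Lemma input_some x z : z < size x -> (input x z.+1 == None) = false.
Proof. by move=> lt; rewrite /input /= (nth_map false). Qed.

Lemma input_end x : input x (size x).+1 = None.
Proof. by rewrite /input /= nth_default ?size_map. Qed.

Section Rounds.

Variables A Q P : finType.

Lemma takes_rewind_input x c (s : st A Q P) :
  takes rewind_input (mk x c s (size x)) (2 * size x + 4) (mk x c s 0).
Proof.
pose mz z : memory13 := fun i => if i == tIn then (input x, z) else mk x c s 0 i.
have loop z : z <= size x ->
    exec (While (fun r => r tIn != None) (Do (shift [:: tIn] MoveL))) (mz z) (z.*2).+1 (mz 0).
  elim: z => [|z IH] lez; first by apply: ExecWhileF; rewrite /mreads ffunE.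
  rewrite doubleS; apply: (@ExecWhileT _ _ _ _ 1 (mz z)) (IH (ltnW lez)).
    by rewrite /mreads ffunE /mread /mz /= input_some.
  have -> : mz z = mdo (shift [:: tIn] MoveL) (mz z.+1).
    by apply: functional_extensionality; elim/ord13_ind.
  by apply: ExecDo; elim/ord13_ind.
apply: (takes_seq (m1 := mz (size x)) (n1 := 1) (n2 := (size x).*2.+1 + 1)); last lia.
  apply: takes_do => //; first by elim/ord13_ind.
  by apply: functional_extensionality; elim/ord13_ind.
exists (1 + ((size x).*2.+1)) => //; first by rewrite addnC.
rewrite addnC; apply: ExecSeq (loop _ (leqnn _)) _.
have -> : mk x c s 0 = mdo (shift [:: tIn] MoveR) (mz 0).
  by apply: functional_extensionality; elim/ord13_ind.
by apply: ExecDo; apply: shiftR_safe.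
Qed.

Definition marks (n : nat) : nat -> cell :=
  fun z => if 0 < z <= n then Some true else None.

Arguments marks : simpl never.

Lemma marksS n : (fun z => if z == n.+1 then Some true else marks n z) = marks n.+1.
Proof.
apply: functional_extensionality => z; rewrite /marks.
by case: eqP => [->|zn]; rewrite ?leqnn //; congr (if _ then _ else _); lia.
Qed.

Lemma takes_copy_input x (s : st A Q P) :
  takes copy_input (mk x (marks 0, 1) s 0) (3 * size x).+1
    (mk x (marks (2 * size x), (2 * size x).+1) s (size x)).
Proof.
exists (3 * size x).+1 => //.
have loop n z : n + z = size x ->
    exec copy_input (mk x (marks (2 * z), (2 * z).+1) s z) (3 * n).+1
      (mk x (marks (2 * size x), (2 * size x).+1) s (size x)).
  elim: n z => [|n IH] z Ez.
    rewrite -{1 2 3}Ez add0n; apply: ExecWhileF.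
    by rewrite /mreads ffunE /mread /= -[z]add0n Ez input_end.
  rewrite (_ : (3 * n.+1).+1 = (1 + 1 + (3 * n).+1).+1); last by lia.
  apply: ExecWhileT; last by apply: (IH z.+1); lia.
    by rewrite /mreads ffunE /mread /= input_some //; lia.
  apply: ExecSeq; first by apply: ExecDo; elim/ord13_ind.
  set m1 := mdo _ _; set a : action 12 := (fun i => if _ then _ else _).
  have -> : mk x (marks (2 * z.+1), (2 * z.+1).+1) s z.+1 = mdo a m1.
    apply: functional_extensionality; elim/ord13_ind => //.
    rewrite /mdo /m1 /a /mdo /= mulnS -[2 + _]/((2 * z).+2).
    by rewrite -!marksS.
  by apply: ExecDo; elim/ord13_ind.
by apply: (loop _ 0); rewrite addn0.
Qed.

Definition raise (s : st A Q P) : st A Q P :=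
  St (bx s) (e1 s) (a1 s) (e2 s) (a2 s) (p1 s) (p2 s) true true (f3 s).

Definition st0 : st A Q P :=
  St set0 set0 set0 set0 set0 set0 set0 false false false.

(** There are [2 * size x] rounds of at most [42 * size x + 7] steps: 40 per bit for the pass, 2 per
    bit for rewinding, and a constant overhead. Hence a quadratic bound. *)
Lemma main_decides x (g : st A Q P -> st A Q P) n :
  (forall s, consumes pass_prog x s (g s)) ->
  200 * (size x).+1 ^ 2 <= n ->
  let s := iter (2 * size x) (g \o raise) st0 in
  tm_decides_within main_tm x n [&& f1 s, f2 s & f3 s].
Proof.
move=> passg le s.
(* The blank to the left of the input stops [rewind_input], and the one to the left of the marks
   ends the main loop. *)
pose h0 (i : 'I_13) := if (i == tIn) || (i == tC) then 1 else 0.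
pose N := 2 * size x.
have round s' z : takes (Seq (Do (put (Some true) [:: tF1; tF2]))
    (Seq pass_prog (Seq rewind_input (Do (shift [:: tC] MoveL)))))
    (mk x (marks N, z.+1) s' 0) (42 * size x + 6) (mk x (marks N, z) (g (raise s')) 0).
  apply: (takes_seq (m1 := mk x (marks N, z.+1) (raise s') 0) (n1 := 1)
            (n2 := 42 * size x + 5)); last lia.
    apply: takes_le (takes_put _ _ _ (leqnn 1)) (leqnn _) _.
    apply: functional_extensionality; elim/ord13_ind => //.
      by rewrite /= (flag_put true).
    by rewrite /= (flag_put true).
  apply: takes_seq (passg (raise s') x (marks N, z.+1) 0 [::] _) _ _.
  - by rewrite drop0 cats0.
  - apply: takes_seq (takes_rewind_input _ _ _) _ (leqnn _).
    apply: takes_do (leqnn 1) _; first by elim/ord13_ind.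
    by apply: functional_extensionality; elim/ord13_ind.
  - lia.
have rounds z s' : z <= N ->
    takes (While (fun r => r tC == Some true) (Seq (Do (put (Some true) [:: tF1; tF2]))
      (Seq pass_prog (Seq rewind_input (Do (shift [:: tC] MoveL))))))
      (mk x (marks N, z) s' 0) (z * (42 * size x + 7)).+1
      (mk x (marks N, 0) (iter z (g \o raise) s') 0).
  elim: z s' => [|z IH] s' lez; first by exists 1 => //; apply: ExecWhileF; rewrite ffunE.
  have [n1 le1 ex1] := round s' z; have [n2 le2 ex2] := IH (g (raise s')) (ltnW lez).
  exists (n1 + n2).+1; first by rewrite mulSn; lia.
  rewrite iterSr; apply: ExecWhileT ex1 ex2.
  by rewrite ffunE /mread /= /marks lez.
have [n1 le1 ex1] : takes main_prog (input_mem x h0)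
    (1 + ((3 * size x).+1 + (2 * size x + 4 + (1 + (N * (42 * size x + 7)).+1))))
    (mk x (marks N, 0) s 0).
  apply: (takes_seq (m1 := mk x (marks 0, 1) st0 0)) _ (leqnn _).
    apply: takes_do => //; apply: functional_extensionality.
    have E (T : finType) : (fun z => if z == 0 then Some false else nth None [::] z)
      = array (@set0 T).
      apply: functional_extensionality => -[|z] //; rewrite /array nth_nil /=.
      by case: existsP => // -[y]; rewrite inE.
    have E' : (fun z => nth None [::] z) = flag false.
      by apply: functional_extensionality => z; rewrite nth_nil /flag andbF.
    have E'' : (fun z => nth None [::] z) = marks 0.
      by apply: functional_extensionality => z; rewrite nth_nil /marks; case: z.
    elim/ord13_ind; rewrite /mdo /input_mem /mk /h0 //=;
      by congr (_, _); first [apply: E | apply: E' | apply: E''].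
  apply: takes_seq (takes_copy_input _ _) _ (leqnn _).
  apply: takes_seq (takes_rewind_input _ _ _) _ (leqnn _).
  apply: takes_seq (rounds _ _ (leqnn _)) (leqnn _).
  apply: takes_do => //; first by elim/ord13_ind.
  by apply: functional_extensionality; elim/ord13_ind.
have -> : [&& f1 s, f2 s & f3 s] = verdict (mreads (mk x (marks N, 0) s 0)).
  by rewrite /verdict /mreads !ffunE /mread /= /flag /= !some_true_if.
apply: prog_tm_decides ex1 _; apply: leq_ltn_trans le1 (leq_trans _ le).
by rewrite /N; nia.
Qed.

End Rounds.

(** * The fixed point between two adjacent boundaries *)

(* If the states of [X] have been activated, these are the states of the list [w]
   that are active or may become so next. *)
Fixpoint front (Q : finType) (X : {set Q}) (w : seq Q) : seq Q :=
  if w is q :: w' then q :: (if q \in X then front X w' else [::]) else [::].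

Lemma front_sub (Q : finType) (X Y : {set Q}) w :
  X \subset Y -> {subset front X w <= front Y w}.
Proof.
move=> XY; elim: w => //= q w IH x; rewrite !inE.
case/predU1P=> [->|]; first by rewrite eqxx.
by case: ifP => // /(subsetP XY) -> /IH ->; rewrite orbT.
Qed.

Section Column.

Variables (A Q P : finType) (tI : {set P * A * P}) (tT : {set Q * (A * A) * Q}).

(** [X] is a set of letters, [Y] and [Z] are the active states on the two sides. Membership in
    [front] allows a transition to fire only when all states listed before its end states are
    active, which enforces the order of first visits. *)
Definition saturated (w : seq Q) (a : A) (w' : seq Q) (X : {set A}) (Y Z : {set Q}) :=
  a \in X /\ forall q b c q', (q, (b, c), q') \in tT ->
    c \in X -> q \in front Y w -> q' \in front Z w' ->
    [/\ b \in X, q \in Y & q' \in Z].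

(* Least fixed point: [w] and [w'] get fully activated by the transitions, in
   the order in which they are listed, and the letters of [B] get produced. *)
Definition column (w : seq Q) (a : A) (w' : seq Q) (B : {set A}) :=
  forall X Y Z, saturated w a w' X Y Z ->
    [/\ {subset w <= Y}, {subset w' <= Z} & B \subset X].

Variables (v v' : seq (option Q)) (p p' : P) (a : A).

Let w := pmap id v.
Let w' := pmap id v'.

Definition pass (s : st A Q P) : st A Q P :=
  let s := foldl (@step_I A Q P) s (enum tI) in
  let s := foldl (@step_T A Q P) s (enum tT) in
  let s := add_p1 (foldl (@step_S1 A Q P) s v) p in
  let s := add_bx s a in
  add_p2 (foldl (@step_S2 A Q P) s v') p'.

Definition round (s : st A Q P) := pass (raise s).

Lemma foldl_step_I s l : foldl (@step_I A Q P) s l =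
  St (bx s) (e1 s) (a1 s) (e2 s) (a2 s) (p1 s) (p2 s) (f1 s) (f2 s)
    (f3 s || has (fun t => [&& t.1.1 \in p1 s, t.1.2 \in bx s & t.2 \in p2 s]) l).
Proof.
elim: l s => [|t l IH] s /=; first by rewrite orbF; case: s.
by rewrite IH; case: s => * /=; rewrite orbA.
Qed.

Lemma foldl_step_S1 s l : foldl (@step_S1 A Q P) s l =
  St (bx s) (e1 s :|: (if f1 s then [set x in front (a1 s) (pmap id l)] else set0))
    (a1 s) (e2 s) (a2 s) (p1 s) (p2 s)
    (f1 s && all (mem (a1 s)) (pmap id l)) (f2 s) (f3 s).
Proof.
elim: l s => [|[q|] l IH] [bx e1 a1 e2 a2 p1 p2 [] f2 f3] //=.
- by congr St; apply/setP=> x; rewrite !inE orbF.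
- by congr St; apply/setP=> x; rewrite !inE orbF.
- rewrite IH /=; congr St; apply/setP=> x; rewrite !inE.
  by case: (q \in a1); rewrite !inE /= -?orbA; case: (x == q); rewrite /= ?orbT ?orbF.
Qed.

Lemma foldl_step_S2 s l : foldl (@step_S2 A Q P) s l =
  St (bx s) (e1 s) (a1 s)
    (e2 s :|: (if f2 s then [set x in front (a2 s) (pmap id l)] else set0))
    (a2 s) (p1 s) (p2 s)
    (f1 s) (f2 s && all (mem (a2 s)) (pmap id l)) (f3 s).
Proof.
elim: l s => [|[q|] l IH] [bx e1 a1 e2 a2 p1 p2 f1 [] f3] //=.
- by congr St; apply/setP=> x; rewrite !inE orbF.
- by congr St; apply/setP=> x; rewrite !inE orbF.
- rewrite IH /=; congr St; apply/setP=> x; rewrite !inE.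
  by case: (q \in a2); rewrite !inE /= -?orbA; case: (x == q); rewrite /= ?orbT ?orbF.
Qed.

(** One point for each bit that can only grow from round to round; [f1] and [f2] are left out, being
    recomputed every time. The cardinality of this type bounds the number of rounds until
    stabilization. *)
Definition fact := (A + (Q + Q) + (Q + Q) + (P + P) + unit)%type.

Definition facts (s : st A Q P) : {set fact} := [set x : fact |
  match x with
  | inl (inl (inl (inl b))) => b \in bx s
  | inl (inl (inl (inr (inl q)))) => q \in e1 s
  | inl (inl (inl (inr (inr q)))) => q \in a1 s
  | inl (inl (inr (inl q))) => q \in e2 s
  | inl (inl (inr (inr q))) => q \in a2 s
  | inl (inr (inl r)) => r \in p1 s
  | inl (inr (inr r)) => r \in p2 s
  | inr _ => f3 s
  end].

Lemma facts_sub s s' :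
  bx s \subset bx s' -> e1 s \subset e1 s' -> a1 s \subset a1 s' ->
  e2 s \subset e2 s' -> a2 s \subset a2 s' -> p1 s \subset p1 s' ->
  p2 s \subset p2 s' -> (f3 s -> f3 s') -> facts s \subset facts s'.
Proof.
move=> /subsetP h1 /subsetP h2 /subsetP h3 /subsetP h4 /subsetP h5 /subsetP h6
  /subsetP h7 h8.
by apply/subsetP=> -[[[[x|[x|x]]|[x|x]]|[x|x]]|x]; rewrite !inE; auto.
Qed.

Lemma raise_facts s s' : facts s = facts s' -> raise s = raise s'.
Proof.
move/setP=> E; rewrite /raise; congr St; try apply/setP=> x.
- by have := E (inl (inl (inl (inl x)))); rewrite !inE.
- by have := E (inl (inl (inl (inr (inl x))))); rewrite !inE.
- by have := E (inl (inl (inl (inr (inr x))))); rewrite !inE.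
- by have := E (inl (inl (inr (inl x)))); rewrite !inE.
- by have := E (inl (inl (inr (inr x)))); rewrite !inE.
- by have := E (inl (inr (inl x))); rewrite !inE.
- by have := E (inl (inr (inr x))); rewrite !inE.
- by have := E (inr tt); rewrite !inE.
Qed.

Lemma step_T_facts s t : facts s \subset facts (@step_T A Q P s t).
Proof.
rewrite /step_T; case: ifP => _ //.
by apply: facts_sub => //=; apply: subsetUr.
Qed.

Lemma foldl_step_T_facts s l : facts s \subset facts (foldl (@step_T A Q P) s l).
Proof.
elim: l s => //= t l IH s; exact: subset_trans (step_T_facts s t) (IH _).
Qed.

Lemma foldl_step_T_flags s l : let s' := foldl (@step_T A Q P) s l in
  (e1 s', e2 s', p1 s', p2 s', f1 s', f2 s', f3 s')
  = (e1 s, e2 s, p1 s, p2 s, f1 s, f2 s, f3 s).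
Proof.
by elim: l s => //= t l IH s; rewrite IH /step_T; case: ifP.
Qed.

(** Steps only add facts, so if the whole fold adds none, no single step does, and every step is
    applied to the same state. *)
Lemma foldl_step_T_fix s l t : facts (foldl (@step_T A Q P) s l) = facts s ->
  t \in l -> facts (step_T s t) = facts s.
Proof.
elim: l s => //= t' l IH s E.
have Es : facts (step_T s t') = facts s.
  apply/eqP; rewrite eqEsubset step_T_facts andbT -E.
  exact: foldl_step_T_facts.
have Ess : step_T s t' = s.
  move/setP: Es => Es; rewrite /step_T; case: s E Es => bx e1 a1 e2 a2 p1 p2 f1 f2 f3 /= E Es.
  rewrite /step_T /= in Es *; case: ifP Es => // _ Es; congr St; apply/setP=> x.
  - by have := Es (inl (inl (inl (inl x)))); rewrite !inE.
  - by have := Es (inl (inl (inl (inr (inr x))))); rewrite !inE.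
  - by have := Es (inl (inl (inr (inr x)))); rewrite !inE.
rewrite inE => /predU1P[->|] //; apply: IH.
by rewrite -[in RHS]E Ess.
Qed.

Definition activated (s : st A Q P) :=
  foldl (@step_T A Q P) (foldl (@step_I A Q P) (raise s) (enum tI)) (enum tT).

Lemma roundE s : round s =
  St (a |: bx (activated s)) (e1 s :|: [set x in front (a1 (activated s)) w])
    (a1 (activated s)) (e2 s :|: [set x in front (a2 (activated s)) w'])
    (a2 (activated s)) (p |: p1 s) (p' |: p2 s)
    (all (mem (a1 (activated s))) w) (all (mem (a2 (activated s))) w')
    (f3 (activated s)).
Proof.
rewrite /round /pass -/(activated s) foldl_step_S2 foldl_step_S1 /=.
have := foldl_step_T_flags (foldl (@step_I A Q P) (raise s) (enum tI)) (enum tT).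
by rewrite -/(activated s) foldl_step_I /= => -[-> -> -> -> -> -> _].
Qed.

Lemma f3_activated s : f3 (activated s) =
  f3 s || [exists t in tI, [&& t.1.1 \in p1 s, t.1.2 \in bx s & t.2 \in p2 s]].
Proof.
have := foldl_step_T_flags (foldl (@step_I A Q P) (raise s) (enum tI)) (enum tT).
rewrite -/(activated s) foldl_step_I /= => -[_ _ _ _ _ _ ->].
congr (_ || _); apply/hasP/existsP => -[t].
  by rewrite mem_enum => ht h; exists t; rewrite ht.
by case/andP=> ht h; exists t; rewrite ?mem_enum.
Qed.

Lemma activated_facts s : facts s \subset facts (activated s).
Proof.
apply: subset_trans (foldl_step_T_facts _ _); rewrite foldl_step_I.
by apply: facts_sub => //= ->.
Qed.

Lemma round_facts s : facts (activated s) \subset facts (round s).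
Proof.
have := foldl_step_T_flags (foldl (@step_I A Q P) (raise s) (enum tI)) (enum tT).
rewrite -/(activated s) foldl_step_I /= => -[E1 E2 E3 E4 _ _ _].
by rewrite roundE; apply: facts_sub; rewrite /= ?E1 ?E2 ?E3 ?E4 ?subsetUl ?subsetUr.
Qed.

(** The sets of facts increase inside a type with fewer than [n] elements, so two consecutive ones
    coincide before round [n]. *)
Lemma iter_round_fix n (s := iter n round (st0 A Q P)) :
  #|A| + 4 * #|Q| + 2 * #|P| + 1 < n -> round s = s.
Proof.
move=> lt.
have mono k : facts (iter k round (st0 A Q P)) \subset facts (iter k.+1 round (st0 A Q P)).
  exact: subset_trans (activated_facts _) (round_facts _).
have [k lek Ek] : exists2 k, k < n &
    facts (iter k.+1 round (st0 A Q P)) = facts (iter k round (st0 A Q P)).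
  have [/existsP[k /eqP Ek]|/existsPn noE] := boolP [exists k : 'I_n,
      facts (iter k.+1 round (st0 A Q P)) == facts (iter k round (st0 A Q P))].
    by exists k.
  have card k : k <= n -> k <= #|facts (iter k round (st0 A Q P))|.
    elim: k => // k IH kn; apply: leq_ltn_trans (IH (ltnW kn)) _.
    apply: proper_card; rewrite properEneq mono andbT eq_sym.
    exact: (noE (Ordinal kn)).
  have := leq_trans (card n (leqnn _)) (max_card _).
  rewrite !card_sum card_unit => le; lia.
(* At stage [k] the flags [f1] and [f2] may still change although the facts do not; one more round,
   which starts by raising them, makes the whole state stable. *)
have fixk : round (iter k.+1 round (st0 A Q P)) = iter k.+1 round (st0 A Q P).
  by rewrite [in RHS]iterS /round; congr pass; apply: raise_facts.
rewrite /s -(subnK lek) iterD -iterS iterSr.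
by rewrite fixk.
Qed.

Section FixedPoint.

Variable s : st A Q P.
Hypothesis fix_s : round s = s.

Lemma facts_activated : facts (activated s) = facts s.
Proof.
by apply/eqP; rewrite eqEsubset activated_facts andbT -{2}fix_s round_facts.
Qed.

Lemma fix_fields :
  [/\ bx s = a |: bx (activated s), a1 s = a1 (activated s), a2 s = a2 (activated s),
      p \in p1 s & p' \in p2 s] /\
  [/\ {subset front (a1 s) w <= e1 s}, {subset front (a2 s) w' <= e2 s},
      f1 s = all (mem (a1 s)) w, f2 s = all (mem (a2 s)) w' &
      f3 s = f3 (activated s)].
Proof.
move: fix_s; rewrite roundE; move: (activated s) => s'.
case: s => bx0 e10 a10 e20 a20 p10 p20 f10 f20 f30 /= [<- E1 <- E2 <- P1 P2 <- <- <-].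
split; split=> //.
- by rewrite -P1 setU11.
- by rewrite -P2 setU11.
- by move=> x xf; rewrite -E1 !inE xf orbT.
- by move=> x xf; rewrite -E2 !inE xf orbT.
Qed.

(** At a fixed point all states of the two fronts are enabled, so each transition considered by
    saturation was tried in the last round. It added nothing, hence its conclusions already hold. *)
Lemma fix_closed : saturated w a w' (bx s) (a1 s) (a2 s).
Proof.
have [[Ebx _ _ _ _] [sub1 sub2 _ _ _]] := fix_fields.
split=> [|q b c q' tq cbx qf q'f]; first by rewrite Ebx setU11.
pose s1 := foldl (@step_I A Q P) (raise s) (enum tI).
have Es1 : facts s1 = facts s.
  apply/eqP; rewrite eqEsubset -{1}facts_activated foldl_step_T_facts /=.
  by rewrite /s1 foldl_step_I; apply: facts_sub => //= ->.
have := @foldl_step_T_fix s1 (enum tT) (q, (b, c), q').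
rewrite -/(activated s) facts_activated mem_enum => /(_ (esym Es1) tq).
rewrite /step_T /s1 foldl_step_I /= sub1 // sub2 // cbx /= => /setP E.
split.
- by have := E (inl (inl (inl (inl b)))); rewrite !inE eqxx => <-.
- by have := E (inl (inl (inl (inr (inr q))))); rewrite !inE eqxx => <-.
- by have := E (inl (inl (inr (inr q')))); rewrite !inE eqxx => <-.
Qed.

End FixedPoint.

(** The invariant behind minimality: what the rounds compute stays inside every saturated triple. *)
Definition sound (X : {set A}) (Y Z : {set Q}) (s : st A Q P) :=
  [/\ bx s \subset X, a1 s \subset Y, a2 s \subset Z,
      {subset e1 s <= front Y w} & {subset e2 s <= front Z w'}] /\
  [/\ p1 s \subset [set p], p2 s \subset [set p'] &
      f3 s -> exists2 u, u \in X & (p, u, p') \in tI].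

Lemma round_sound X Y Z s : saturated w a w' X Y Z -> sound X Y Z s -> sound X Y Z (round s).
Proof.
move=> [aX cl] [[sX sY sZ sE1 sE2] [sP1 sP2 sF]].
have [hX hY hZ] : [/\ bx (activated s) \subset X, a1 (activated s) \subset Y &
    a2 (activated s) \subset Z].
  have ind l s1 : {subset l <= tT} -> bx s1 \subset X -> a1 s1 \subset Y ->
      a2 s1 \subset Z -> {subset e1 s1 <= front Y w} -> {subset e2 s1 <= front Z w'} ->
      let s2 := foldl (@step_T A Q P) s1 l in
      [/\ bx s2 \subset X, a1 s2 \subset Y & a2 s2 \subset Z].
    elim: l s1 => //= -[[q [b c]] q'] l IH s1 lT hX hY hZ hE1 hE2.
    have lT' : {subset l <= tT} by move=> t tl; apply: lT; rewrite inE tl orbT.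
    rewrite /step_T; case: ifP => [/and3P[/= h1 h2 h3]|_]; last exact: IH.
    have [] := cl q b c q' (lT _ (mem_head _ _)) (subsetP hX _ h2) (hE1 _ h1) (hE2 _ h3).
    by move=> bX qY qZ; apply: IH; rewrite //= subUset sub1set ?bX ?qY ?qZ.
  apply: ind; rewrite ?foldl_step_I //.
  by move=> t; rewrite mem_enum.
rewrite roundE; split; split=> //=.
- by rewrite subUset sub1set aX.
- by move=> x; rewrite !inE => /orP[/sE1|/(front_sub hY)].
- by move=> x; rewrite !inE => /orP[/sE2|/(front_sub hZ)].
- by rewrite subUset subxx.
- by rewrite subUset subxx.
- rewrite f3_activated => /orP[/sF //|/existsP[[[r u] r'] /and4P[/= tr rp ux rp']]].
  exists u; first exact: subsetP sX _ ux.
  have /set1P <- := subsetP sP1 _ rp.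
  by have /set1P <- := subsetP sP2 _ rp'.
Qed.

Lemma iter_round_sound X Y Z n : saturated w a w' X Y Z -> sound X Y Z (iter n round (st0 A Q P)).
Proof.
move=> cl; elim: n => [|n IH]; last exact: round_sound.
by split; split=> //=; rewrite ?sub0set // => x; rewrite inE.
Qed.

(** By [fix_closed] the computed sets are saturated, and by [iter_round_sound] they lie in every
    saturated triple. They are thus the least one, to which [column] refers. *)
Lemma iter_round_accept n (s := iter n round (st0 A Q P)) :
  #|A| + 4 * #|Q| + 2 * #|P| + 1 < n ->
  [&& f1 s, f2 s & f3 s] <->
  exists2 u, (p, u, p') \in tI & column w a w' [set u].
Proof.
move=> /iter_round_fix; rewrite -/s => fix_s.
have cl := fix_closed fix_s.
have [[_ _ _ pp1 pp2] [_ _ -> -> Ef3]] := fix_fields fix_s.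
split=> [/and3P[/allP h1 /allP h2]|[u tu col]].
  have [_ [_ _ f3P]] := iter_round_sound n cl.
  case/f3P=> u ux tu; exists u => // X Y Z /(iter_round_sound n)[[sX sY sZ _ _] _].
  split=> [q /h1 /(subsetP sY) //|q /h2 /(subsetP sZ) //|].
  by rewrite sub1set (subsetP sX).
have [h1 h2] := col _ _ _ cl; rewrite sub1set => ux.
apply/and3P; split; [exact/allP|exact/allP|].
rewrite Ef3 f3_activated; apply/orP; right; apply/existsP.
by exists (p, u, p'); rewrite tu pp1 ux pp2.
Qed.

End Column.

(** * Correctness of the guessed orders of activation *)

Lemma mem_front (Q : finType) (X : {set Q}) w : {subset front X w <= w}.
Proof.
elim: w => //= q w IH x; rewrite !inE => /predU1P[->|]; first by rewrite eqxx.
by case: ifP => // _ /IH ->; rewrite orbT.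
Qed.

Lemma front_closed (Q : finType) (X : {set Q}) w :
  {subset front X w <= X} -> {subset w <= X}.
Proof.
elim: w => //= q w IH h; have qX : q \in X by apply: h; rewrite mem_head.
move=> x; rewrite inE => /predU1P[->|] //; apply: IH => y yf.
by apply: h; rewrite qX inE yf orbT.
Qed.

(** The front ends at its first element outside [X], so at most one state in it is not in [X]. *)
Lemma front_exit (Q : finType) (X : {set Q}) w x y :
  x \in front X w -> x \notin X -> y \in front X w -> y \in X \/ y = x.
Proof.
elim: w => //= q w IH; case: (boolP (q \in X)) => qX; rewrite !inE.
  case/predU1P=> [->|xf]; first by rewrite qX.
  by move=> xX /predU1P[->|]; [left|apply: IH].
by move=> /eqP-> _ /eqP->; right.
Qed.

Lemma front_rcons (Q : finType) (X : {set Q}) w q : {subset w <= X} ->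
  q \in front X (rcons w q).
Proof.
elim: w => [|x w IH] h /=; first exact: mem_head.
rewrite h ?mem_head // inE IH ?orbT // => y yw.
by apply: h; rewrite inE yw orbT.
Qed.

Lemma front_rcons_sub (Q : finType) (X : {set Q}) w q :
  {subset front X w <= front X (rcons w q)}.
Proof.
elim: w => //= x w IH y; rewrite !inE => /predU1P[->|]; first by rewrite eqxx.
by case: ifP => // _ /IH ->; rewrite orbT.
Qed.

Definition inbox (A : finType) (u : seq A) (bs : seq {set A}) :=
  all2 (fun x (B : {set A}) => x \in B) u bs.

Lemma inbox_size (A : finType) (u : seq A) bs : inbox u bs -> size u = size bs.
Proof. by rewrite /inbox all2E => /andP[/eqP]. Qed.

Lemma inboxP (A : finType) (u : seq A) bs : size u = size bs ->
  reflect (forall i x, onth u i = Some x -> x \in nth set0 bs i) (inbox u bs).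
Proof.
elim: u bs => [|x u IH] [|B bs] //= => [_|[/IH{}IH]].
  by left; case.
apply: (iffP andP) => [[xB /IH h] [|i] y /=|h]; first by case=> <-.
  exact: h.
by split; [apply: (h 0)|apply/IH=> i y; apply: (h i.+1)].
Qed.

(** * Soundness: an accepted word is reachable from the guessed initial configuration *)

Section IndInv.

Variable R : rts.

Local Notation A := (letter R).
Local Notation Q := (stateT R).
Local Notation P := (stateI R).
Local Notation tT := (nfa_trans (autT R)).
Local Notation tI := (nfa_trans (autI R)).
Local Notation column := (column tT).

(** Accepting runs of the automaton, with each state reduced to its list [w] and its state [p]. The
    last word is the initial configuration guessed along the way. *)
Inductive run : seq Q -> P -> seq A -> seq A -> Prop :=
  | RunNil w p of {subset w <= nfa_final (autT R)} & p \in nfa_final (autI R) :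
      run w p [::] [::]
  | RunCons w p a w' p' x y u of (p, u, p') \in tI & column w a w' [set u]
      & run w' p' x y : run w p (a :: x) (u :: y).

Lemma run_accepts w p x y : run w p x y -> nfa_accepts_from (autI R) p y.
Proof.
elim=> // {}w {}p a w' p' {}x {}y u tu _ _ IH /=.
by apply/existsP; exists p'; rewrite tu.
Qed.

Lemma run_size w p x y : run w p x y -> size x = size y.
Proof. by elim=> //= {}w {}p a w' p' {}x {}y u _ _ _ ->. Qed.

(** For [L] the initial states, the box [bs] is closed under predecessors. Other sets [L] serve for
    suffixes: they hold the states reachable through the letters of the box already passed. *)
Definition back_closed (L : {set Q}) (bs : seq {set A}) := forall q v u,
  q \in L -> size v = size u -> nfa_accepts_from (autT R) q (zip v u) ->
  inbox u bs -> inbox v bs.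

(** Only target letters are required to lie in the box; for a complete run from [L], closure then
    forces the source letters into it. *)
Fixpoint co_reach (bs : seq {set A}) : {set Q} :=
  if bs is B :: bs' then
    [set q | [exists t in tT, [&& t.1.1 == q, t.1.2.2 \in B & t.2 \in co_reach bs']]]
  else nfa_final (autT R).

Definition reach (L : {set Q}) (B : {set A}) : {set Q} :=
  [set q' | [exists t in tT, [&& t.1.1 \in L, t.1.2.2 \in B & t.2 == q']]].

Lemma co_reachP q bs : q \in co_reach bs -> exists v u,
  [/\ size v = size u, inbox u bs & nfa_accepts_from (autT R) q (zip v u)].
Proof.
elim: bs q => [|B bs IH] q /=; first by exists [::], [::].
rewrite inE => /existsP[[[q1 [a b]] q']] /and4P[/= tt /eqP <- bB /IH[v [u [E uB ac]]]].
exists (a :: v), (b :: u); split=> /=; [by rewrite E|by rewrite bB|].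
by apply/existsP; exists q'; rewrite tt.
Qed.

Lemma co_reach_cons q a b q' (B : {set A}) bs : (q, (a, b), q') \in tT -> b \in B ->
  q' \in co_reach bs -> q \in co_reach (B :: bs).
Proof.
by move=> tt bB h; rewrite inE; apply/existsP; exists (q, (a, b), q'); rewrite tt eqxx bB.
Qed.

Lemma reach_cons (L : {set Q}) q a b q' (B : {set A}) :
  (q, (a, b), q') \in tT -> q \in L -> b \in B -> q' \in reach L B.
Proof.
by move=> tt qL bB; rewrite inE; apply/existsP; exists (q, (a, b), q'); rewrite tt qL bB /=.
Qed.

Lemma back_closed_cons L B bs : back_closed L (B :: bs) -> back_closed (reach L B) bs.
Proof.
move=> bc q' v u; rewrite inE => /existsP[[[q [a b]] q1]] /and4P[/= tt qL bB /eqP Eq].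
rewrite {}Eq in tt => E ac uB.
have /andP[] // : inbox (a :: v) (B :: bs).
apply: (bc q _ (b :: u)) => //=; first by rewrite E.
  by apply/existsP; exists q'; rewrite tt.
by rewrite bB.
Qed.

(* A state of [front V w] outside [V] is the first of [w] that no run through
   the box visits. The states of [w] before it are reached in time, so if it is
   reachable from the left, then so is the first such state of the next list;
   at the end of the word there cannot be one. *)
Lemma run_sound w p x y L bs : run w p x y -> inbox x bs -> back_closed L bs ->
  {subset front (L :&: co_reach bs) w <= L} ->
  {subset w <= L :&: co_reach bs} /\ inbox y bs.
Proof.
move=> r; elim: r L bs => {w p x y} [w p wF pF|w p a w' p' x y u tu col r IH] L [|B bs] //=.
  move=> _ _ wL; split=> //; apply: front_closed => q qf; rewrite inE wL //.
  exact/wF/(mem_front qf).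
case/andP=> aB xbs bc wL.
set V := L :&: _ in wL *; set L' := reach L B; set V' := L' :&: co_reach bs.
(* Under this assumption both end states of the transition lie on a run through the box, reachable
   from [L] and leading to acceptance, so closure puts the source letter [b] into [B]. *)
have step : (forall q', q' \in front V' w' -> q' \in L' -> q' \in V') ->
    saturated tT w a w' B V V'.
  move=> h; split=> // q b c q' tq cB /wL qL q'f.
  have q'L := reach_cons tq qL cB.
  have q'V := h _ q'f q'L; have /setIP[_ q'R] := q'V.
  have qR := co_reach_cons tq cB q'R.
  split=> //; last by apply/setIP; split; rewrite ?inE in qR *.
  have [v [z [E zbs ac]]] := co_reachP q'R.
  have /andP[] // : inbox (b :: v) (B :: bs).
  apply: (bc q _ (c :: z)) => //=; first by rewrite E.
    by apply/existsP; exists q'; rewrite tq.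
  by rewrite cB.
(* If the front contains a state of [L'] outside [V'], it is the only one outside [V'], and the rest
   is in [L'] anyway. If there is none, [step] applies and the column puts all of [w'] into [V']. *)
have inv : {subset front V' w' <= L'}.
  case: (boolP (has (fun q' => (q' \in L') && (q' \notin V')) (front V' w'))).
    case/hasP=> q0 q0f /andP[q0L q0V] q' q'f.
    by case: (front_exit q0f q0V q'f) => [/setIP[]|->].
  move/hasPn=> h; have /step/col[_ w'V _] : forall q', q' \in front V' w' ->
      q' \in L' -> q' \in V'.
    by move=> q' /h; rewrite negb_and negbK => /orP[/negbTE->|].
  by move=> q' /mem_front/w'V/setIP[].
have [w'V ybs] := IH _ _ xbs (back_closed_cons bc) inv.
have /step/col[wV _ uB] : forall q', q' \in front V' w' -> q' \in L' -> q' \in V'.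
  by move=> q' /mem_front/w'V.
by split=> //; rewrite ybs andbT -sub1set.
Qed.

(** * Clauses as complements of boxes *)

Definition is_atom l (q : A) (j : 'I_l) (z : literal A l) :=
  if z is Atom p i then (i == j) && (p == q) else false.

(** By De Morgan, the box of the configurations that violate [c]. This breaks down if [c] contains
    [true], whence the side condition in the next lemmas. *)
Definition clause_box l (c : seq (literal A l)) : seq {set A} :=
  [seq [set x | ~~ has (is_atom x j) c] | j <- enum 'I_l].

Definition is_true_literal l (z : literal A l) := if z is LTrue then true else false.

Lemma clause_satP l (c : seq (literal A l)) (y : seq A) :
  ~~ has (@is_true_literal l) c ->
  has (literal_sat y) c <-> exists j q, onth y (val j) = Some q /\ has (is_atom q j) c.
Proof.
elim: c => [_|z c IH] /=; first by split=> // -[j [q []]].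
rewrite negb_or => /andP[zT /IH{}IH]; split.
  case/orP=> [|/IH[j [q [yj h]]]]; last by exists j, q; rewrite h orbT.
  by case: z zT => //= q j _ /eqP yj; exists j, q; rewrite !eqxx.
case=> j [q [yj /orP[|h]]]; last by apply/orP; right; apply/IH; exists j, q.
by case: z zT => //= p i _ /andP[/eqP-> /eqP->]; rewrite yj eqxx.
Qed.

Lemma clause_boxE l (c : seq (literal A l)) (y : seq A) : size y = l ->
  ~~ has (@is_true_literal l) c -> has (literal_sat y) c = ~~ inbox y (clause_box c).
Proof.
move=> Ey noT.
have Es : size y = size (clause_box c) by rewrite size_map -cardE card_ord.
have nthE (j : 'I_l) : nth set0 (clause_box c) j = [set x | ~~ has (is_atom x j) c].
  by rewrite (nth_map j) ?nth_ord_enum // -cardE card_ord.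
apply/idP/idP => [/(clause_satP _ noT)[j [q [yj h]]]|].
  by apply/(inboxP Es) => /(_ j q yj); rewrite nthE inE h.
apply: contraNT => h; apply/(inboxP Es) => i x yi.
have il : i < l.
  by rewrite -Ey ltnNge; apply/negP => /onth_default E; rewrite E in yi.
rewrite (nthE (Ordinal il)) inE; apply: contra h => h.
by apply/(clause_satP _ noT); exists (Ordinal il), x.
Qed.

(** If [x] violated an inductive clause that [y] satisfies, it would lie in the complementary box.
    Inductiveness closes this box under predecessors, so [run_sound] would put [y] into it as
    well. *)
Lemma run_IndInv w p x y : run w p x y -> {subset w <= nfa_init (autT R)} ->
  reach1 y x.
Proof.
move=> r wI l [|c] ind yc //= El; case/boolP: (has _ c) => // xc.
have noT : ~~ has (@is_true_literal l) c.
  by apply: contra xc; apply: sub_has; case.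
rewrite clause_boxE // negbK in xc.
have bc : back_closed (nfa_init (autT R)) (clause_box c).
  move=> q v u qI E ac uB; have Eu : size u = l.
    by rewrite (inbox_size uB) size_map -cardE card_ord.
  apply/negPn; rewrite -clause_boxE ?E //; apply/negP => vc.
  have /(_ Eu) : formula1_sat (Clause c) u.
    apply: (ind v) => [_ //|]; split=> //.
    by apply/existsP; exists q; rewrite qI.
  by rewrite /= clause_boxE // uB.
have [|_ yB] := run_sound r xc bc.
  by move=> q /mem_front/wI.
by have := yc (etrans (esym (run_size r)) El); rewrite clause_boxE ?yB // -(run_size r).
Qed.

(** The counterpart of [run] for completeness: instead of one guessed letter, a whole set [B] of
    letters that the column produces. The initial automaton does not occur here. *)
Inductive chain : seq Q -> seq A -> seq {set A} -> Prop :=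
  | ChainNil w of uniq w & {subset w <= nfa_final (autT R)} : chain w [::] [::]
  | ChainCons w a w' (B : {set A}) x bs of uniq w & column w a w' B & a \in B
      & chain w' x bs : chain w (a :: x) (B :: bs).

Lemma chain_init x : chain [::] x [seq [set a] | a <- x].
Proof.
elim: x => [|a x IH]; first exact: ChainNil.
apply: ChainCons (IH) => //; last by rewrite inE.
by move=> X Y Z [aX _]; split=> //; rewrite sub1set.
Qed.

Lemma chain_inbox w x bs : chain w x bs -> inbox x bs.
Proof. by elim=> // {}w a w' B {}x {}bs _ _ aB _ IH; rewrite /= aB. Qed.

(** * Completeness: growing the box by one run at a time *)

Definition extend (w : seq Q) q := if q \in w then w else rcons w q.

Lemma extend_uniq w q : uniq w -> uniq (extend w q).
Proof. by rewrite /extend; case: ifP => // qw; rewrite rcons_uniq qw. Qed.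

Lemma front_extend_sub (X : {set Q}) w q : {subset front X w <= front X (extend w q)}.
Proof. by rewrite /extend; case: ifP => _ x; [|apply: front_rcons_sub]. Qed.

Lemma front_all (X : {set Q}) w : {subset w <= X} -> {subset w <= front X w}.
Proof.
elim: w => //= q w IH h x; rewrite !inE h ?mem_head // => /predU1P[->|xw].
  by rewrite eqxx.
by rewrite IH ?orbT // => y yw; apply: h; rewrite inE yw orbT.
Qed.

Lemma front_extend (X : {set Q}) w q : {subset w <= X} -> q \in front X (extend w q).
Proof.
move=> wX; rewrite /extend; case: ifP => [qw|_]; last exact: front_rcons.
exact: front_all.
Qed.

Lemma extend_sub (X : {set Q}) w q : {subset w <= X} -> q \in X ->
  {subset extend w q <= X}.
Proof.
move=> wX qX x; rewrite /extend; case: ifP => _; first exact: wX.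
by rewrite mem_rcons inE => /predU1P[->|/wX].
Qed.

(** A state not yet listed is appended at the end. In any saturated triple the old column activates
    all earlier states, after which the new transition can fire. *)
Lemma column_extend w a w' B q b c q' : column w a w' B -> (q, (b, c), q') \in tT ->
  c \in B -> column (extend w q) a (extend w' q') (b |: B).
Proof.
move=> col tq cB X Y Z [aX cl].
have [wY w'Z BX] : [/\ {subset w <= Y}, {subset w' <= Z} & B \subset X].
  apply: col; split=> // q1 b1 c1 q1' t1 c1X h h'.
  by apply: cl t1 c1X _ _; apply: front_extend_sub.
have [bX qY q'Z] := cl q b c q' tq (subsetP BX _ cB) (front_extend q wY) (front_extend q' w'Z).
by split; [apply: extend_sub|apply: extend_sub|rewrite subUset sub1set bX].
Qed.

(** Each boundary list receives the state that the run visits there, and each component of the box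
    the corresponding letter of the predecessor [v]. *)
Lemma chain_extend w x bs q v u : chain w x bs -> size v = size u ->
  nfa_accepts_from (autT R) q (zip v u) -> inbox u bs ->
  chain (extend w q) x [seq t.1 |: t.2 | t <- zip v bs].
Proof.
move=> ch; elim: ch q v u => {w x bs} [w uw wF|w a w' B x bs uw col aB _ IH] q [|b v] [|c u] //=.
  move=> _ qF _; apply: ChainNil; first exact: extend_uniq.
  exact: extend_sub.
case=> E /existsP[q' /andP[tq ac]] /andP[cB uB].
apply: ChainCons (IH _ _ _ E ac uB); first exact: extend_uniq.
  exact: column_extend col tq cB.
by rewrite inE aB orbT.
Qed.

Definition box_weight (bs : seq {set A}) := sumn [seq #|B| | B : {set A} <- bs].

Lemma box_weight_le bs : box_weight bs <= size bs * #|A|.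
Proof.
by elim: bs => //= B bs IH; rewrite /box_weight /= mulSn leq_add ?max_card.
Qed.

Lemma box_weight_extend v bs : size v = size bs ->
  box_weight bs + ~~ inbox v bs <= box_weight [seq t.1 |: t.2 | t <- zip v bs].
Proof.
elim: v bs => [|b v IH] [|B bs] //= [/IH{}IH]; rewrite /box_weight /= -/(box_weight _) in IH *.
rewrite cardsU1; case: (b \in B) => /=; lia.
Qed.

Lemma back_closed_dec (L : {set Q}) bs : back_closed L bs \/ exists q v u,
  [/\ q \in L, size v = size u, nfa_accepts_from (autT R) q (zip v u),
      inbox u bs & ~~ inbox v bs].
Proof.
pose bad := [exists v : (size bs).-tuple A, [exists u : (size bs).-tuple A,
  [exists q in L, [&& nfa_accepts_from (autT R) q (zip v u),
     inbox u bs & ~~ inbox v bs]]]].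
have [/existsP[v /existsP[u /existsP[q /and4P[qL ac uB vB]]]]|nbad] := boolP bad.
  by right; exists q, v, u; rewrite !size_tuple.
left=> q v u qL E ac uB; apply: contraR nbad => vB.
have su := inbox_size uB; have sv := etrans E su.
apply/existsP; exists (Tuple (introT eqP sv)); apply/existsP; exists (Tuple (introT eqP su)).
by apply/existsP; exists q; rewrite qL ac uB.
Qed.

(** Starting from the box containing only [x], runs that violate closure are added one after the
    other. Each adds a letter somewhere, and the total size is at most [size x * #|A|], so this
    ends. *)
Lemma chain_closed x : exists w bs,
  [/\ chain w x bs, {subset w <= nfa_init (autT R)} & back_closed (nfa_init (autT R)) bs].
Proof.
have [n] := ubnP (size x * #|A| - box_weight [seq [set a] | a <- x]).
have : {subset ([::] : seq Q) <= nfa_init (autT R)} by [].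
elim: n [::] [seq _ | _ <- x] (chain_init x) => // n IH w bs ch wI le.
have [bc|[q [v [u [qI E ac uB vB]]]]] := back_closed_dec (nfa_init (autT R)) bs.
  by exists w, bs.
have ch' := chain_extend ch E ac uB.
apply: (IH _ _ ch' (extend_sub wI qI)).
have := box_weight_le [seq t.1 |: t.2 | t <- zip v bs].
have := @box_weight_extend v bs; rewrite vB => /(_ (etrans E (inbox_size uB))).
by rewrite -(inbox_size (chain_inbox ch')); lia.
Qed.

Definition box_clause l (bs : seq {set A}) : seq (literal A l) :=
  flatten [seq [seq Atom q j | q <- enum (~: nth set0 bs (val j))] | j <- enum 'I_l].

(** The clause whose complement is the box is inductive, since the box is closed under predecessors.
    If [u] were outside the box, it would satisfy this clause, and hence so would [x]. *)
Lemma reach1_inbox (u x : seq A) bs : reach1 u x -> inbox x bs ->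
  back_closed (nfa_init (autT R)) bs -> inbox u bs.
Proof.
move=> ux xB bc; have Ex := inbox_size xB.
pose l := size bs.
have satE (y : seq A) : size y = l ->
    has (literal_sat y) (box_clause l bs) = ~~ inbox y bs.
  move=> Ey; have -> : has (literal_sat y) (box_clause l bs) = has (fun j : 'I_l =>
      has (fun q => onth y j == Some q) (enum (~: nth set0 bs (val j)))) (enum 'I_l).
    rewrite /box_clause; elim: (enum _) => //= j s <-.
    by rewrite has_cat has_map.
  apply/hasP/idP => [[j _ /hasP[q]]|].
    rewrite mem_enum inE => qB /eqP yj; apply/(inboxP Ey) => /(_ _ _ yj).
    exact/negP.
  move=> yB; apply/hasP; apply: contraR yB => /hasPn h; apply/(inboxP Ey) => i q yi.
  have il : i < l.
    by rewrite -Ey ltnNge; apply/negP => /onth_default E; rewrite E in yi.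
  have := h (Ordinal il) (mem_enum _ _) => /hasPn/(_ q); rewrite mem_enum inE /= yi eqxx.
  by case: (q \in _) => // /(_ isT).
apply/negPn/negP => uB.
have ind : inductive_set (R := R) (formula1_sat (Clause (box_clause l bs))).
  move=> v z /= vC [E /existsP[q /andP[qI ac]]] Ez; rewrite satE //.
  apply: contraTN (vC (etrans E Ez)) => zB; rewrite satE ?(etrans E Ez) // negbK.
  exact: bc ac zB.
have uC : formula1_sat (Clause (box_clause l bs)) u by move=> Eu'; rewrite satE.
by have := ux _ _ ind uC Ex; rewrite /= satE // xB.
Qed.

End IndInv.

(** * The automaton *)

(** Used with [m = n ^ 2]; treating the square as a variable makes the estimate linear. *)
Lemma query_size_arith n m A P Q k1 k2 k3 k4 k5 k6 k7 k8 k9 k10 k11 : 0 < n -> n <= m -> A <= n -> P <= n -> Q <= n ->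
 k1 <= 1 + (n + 1 * m) -> k2 <= 1 + (n + 1 * m) -> k3 <= 1 + (n + 1 * m) -> k4 <= 1 + (n + 1 * m) ->
 k5 <= 1 + (n + 3 * m) ->
 k6 <= 1 + (n + 4 * m) -> k7 <= 1 + (n + (n + m)) -> k8 <= 1 + (n + (n + m)) -> k9 <= n -> k10 <= n -> k11 <= n ->
 (A.+1 + (P.+1 + (Q.+1 + (k1 + (k5 + (k2 + (k3 + (k6 + (k4 + (k7 + (1 + (1 + (1 + (k9 + (k11 + (k8 + (1 + (1 + (1 + k10))))))))))))))))))).+1 <= 47 * m.
Proof. lia. Qed.

Section Automaton.

Variable R : rts.

Local Notation A := (letter R).
Local Notation Q := (stateT R).
Local Notation P := (stateI R).
Local Notation tT := (nfa_trans (autT R)).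
Local Notation tI := (nfa_trans (autI R)).

(* A list of states and a state of [autI R] suffice: the rest is constant. *)
Definition A1_set : {set A1_state R} := [set q | q.1.1.2 == (set0, set0) & ~~ q.1.2].

Definition A1_sub := {q : A1_state R | q \in A1_set}.

Implicit Types q : A1_sub.

Definition slots q : seq (option Q) := (val q).1.1.1.
Definition word q : seq Q := pmap id (slots q).
Definition base q : P := (val q).2.

Definition query q (a : A) q' := enc_query (val q) a (val q').

(** Transitions are defined as the outcome of the rounds that the machine performs; [acceptP] gives
    their meaning. *)
Definition accept q a q' : bool :=
  let s := iter (2 * size (query q a q'))
    (round tI tT (slots q) (slots q') (base q) (base q') a) (st0 A Q P) in
  [&& f1 s, f2 s & f3 s].

Definition A1 : nfa A A1_sub :=
  NFA [set q | all (mem (nfa_init (autT R))) (word q) & base q \in nfa_init (autI R)]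
      [set t | accept t.1.1 t.1.2 t.2]
      [set q | all (mem (nfa_final (autT R))) (word q) & base q \in nfa_final (autI R)].

Definition enc_transI (t : P * A * P) : seq bool :=
  enc_elt t.1.1 ++ enc_elt t.1.2 ++ enc_elt t.2.
Definition enc_transT (t : Q * (A * A) * Q) : seq bool :=
  enc_elt t.1.1 ++ (enc_elt t.1.2.1 ++ enc_elt t.1.2.2) ++ enc_elt t.2.
Definition enc_slots q := enc_seq (enc_option (@enc_elt Q)) (slots q).

Lemma queryE q a q' : query q a q' =
  enc_nat #|A| ++ enc_nat #|P| ++ enc_nat #|Q| ++
  enc_set (@enc_elt P) (nfa_init (autI R)) ++ enc_set enc_transI tI ++
  enc_set (@enc_elt P) (nfa_final (autI R)) ++
  enc_set (@enc_elt Q) (nfa_init (autT R)) ++ enc_set enc_transT tT ++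
  enc_set (@enc_elt Q) (nfa_final (autT R)) ++
  enc_slots q ++ [:: false] ++ [:: false] ++ [:: false] ++ enc_elt (base q) ++
  enc_elt a ++
  enc_slots q' ++ [:: false] ++ [:: false] ++ [:: false] ++ enc_elt (base q').
Proof.
rewrite /query /enc_query /enc_rts /enc_nfa -!catA /enc_slots /slots /base.
case: q => [[[[v [X Y]] b] p] /= qS]; case: q' => [[[[v' [X' Y']] b'] p'] /= qS'].
move: qS qS'; rewrite !inE /= => /andP[/eqP[-> ->] /negbTE->] /andP[/eqP[-> ->] /negbTE->].
by rewrite /enc_set !enum_set0 -!catA.
Qed.

Lemma consumes_skips (T : finType) (X : {set T}) s :
  @consumes A Q P (each (seek [::])) (enc_set (@enc_elt T) X) s s.
Proof.
have {2}-> : s = foldl (fun s _ => s) s (enum X) by elim: (enum X).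
by apply: consumes_each => t s' _; apply: consumes_skip.
Qed.

Lemma consumes_pass q a q' s : consumes pass_prog (query q a q') s
  (pass tI tT (slots q) (slots q') (base q) (base q') a s).
Proof.
rewrite queryE; do 3![apply: consumes_seq; first exact: consumes_skip].
apply: consumes_seq; first exact: consumes_skips.
apply: consumes_seq.
  by apply: consumes_each => t s' _; apply: consumes_test_I.
do 2![apply: consumes_seq; first exact: consumes_skips].
apply: consumes_seq.
  by apply: consumes_each => t s' _; apply: consumes_test_T.
apply: consumes_seq; first exact: consumes_skips.
apply: consumes_seq.
  by apply: consumes_each => t s' _; apply: consumes_scan1.
do 3![apply: consumes_seq; first exact: consumes_bit].
apply: consumes_seq; first exact: consumes_add_p1.
apply: consumes_seq; first exact: consumes_add_bx.
apply: consumes_seq.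
  by apply: consumes_each => t s' _; apply: consumes_scan2.
do 3![apply: consumes_seq; first exact: consumes_bit].
exact: consumes_add_p2.
Qed.

(** * Bounds on the size of a query *)

Lemma size_enc_elt (T : finType) (x : T) : 0 < size (enc_elt x) <= #|T|.
Proof. by rewrite size_enc_nat /= ltn_ord. Qed.

Lemma size_enc_seq_le (T : eqType) (enc : T -> seq bool) l n :
  (forall x, x \in l -> size (enc x) <= n) ->
  size (enc_seq enc l) <= 1 + size l * (1 + n).
Proof.
move=> le; rewrite size_rcons size_flatten /shape -map_comp add1n ltnS.
elim: l le => //= x l IH le; rewrite mulSn; apply: leq_add.
  by rewrite add1n ltnS le ?mem_head.
by apply: IH => y yl; apply: le; rewrite inE yl orbT.
Qed.

Lemma size_enc_seq_ge (T : Type) (enc : T -> seq bool) l : size l < size (enc_seq enc l).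
Proof.
rewrite size_rcons ltnS size_flatten /shape -map_comp.
by elim: l => //= x l IH; lia.
Qed.

Lemma size_slots q : size (slots q) = #|Q|.
Proof. exact: size_tuple. Qed.

(** This is why two marks per input bit suffice: the header has a bit for every letter and state,
    and the slots of [q] give at least one more bit for each state of the transducer. *)
Lemma size_query_ge q a q' : #|A| + 4 * #|Q| + 2 * #|P| + 1 < 2 * size (query q a q').
Proof.
rewrite queryE !size_cat !size_enc_nat.
have := @size_enc_seq_ge _ (enc_option (@enc_elt Q)) (slots q).
by rewrite size_slots /enc_slots; lia.
Qed.

Lemma size_query_le q a q' : (size (query q a q')).+1 <= 47 * rts_size R ^ 2.
Proof.
set n := rts_size R.
have nA : #|A| <= n by rewrite /n /rts_size; lia.
have nP : #|P| <= n by rewrite /n /rts_size; lia.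
have nQ : #|Q| <= n by rewrite /n /rts_size; lia.
have ntI : #|tI| <= n by rewrite /n /rts_size; lia.
have ntT : #|tT| <= n by rewrite /n /rts_size; lia.
have n0 : 0 < n by apply: leq_trans nP; apply/card_gt0P; exists (base q).
have elt (T : finType) (x : T) : #|T| <= n -> size (enc_elt x) <= n.
  by apply: leq_trans; have /andP[] := size_enc_elt x.
have enc_set_le (T : finType) (enc : T -> seq bool) (X : {set T}) k :
    #|X| <= n -> (forall x, size (enc x) <= k * n) ->
    size (enc_set enc X) <= 1 + n * (1 + k * n).
  move=> leX le; apply: leq_trans (size_enc_seq_le (fun x _ => le x)) _.
  by rewrite leq_add2l leq_mul2r -cardE leX orbT.
have set_le (T : finType) (X : {set T}) : #|T| <= n ->
    size (enc_set (@enc_elt T) X) <= 1 + n * (1 + 1 * n).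
  move=> leT; apply: enc_set_le => [|x]; first exact: leq_trans (max_card _) leT.
  by rewrite mul1n elt.
have slots_le q1 : size (enc_slots q1) <= 1 + n * (1 + (1 + n)).
  apply: (@leq_trans (1 + size (slots q1) * (1 + (1 + n)))).
    apply: size_enc_seq_le => -[x|] _ //=.
    by rewrite add1n ltnS elt.
  by rewrite size_slots leq_add2l leq_mul2r nQ orbT.
have hT t : size (enc_transT t) <= 4 * n.
  rewrite !size_cat; have := elt _ t.1.1 nQ; have := elt _ t.2 nQ.
  by have := elt _ t.1.2.1 nA; have := elt _ t.1.2.2 nA; lia.
have hI t : size (enc_transI t) <= 3 * n.
  rewrite !size_cat; have := elt _ t.1.1 nP; have := elt _ t.2 nP.
  by have := elt _ t.1.2 nA; lia.
have E k : n * (1 + k * n) = n + k * n ^ 2 by rewrite mulnDr muln1 mulnCA mulnn.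
have E' : n * (1 + (1 + n)) = n + (n + n ^ 2) by rewrite -mulnn; clear; nia.
have nn : n <= n ^ 2 by rewrite -{1}[n]expn1 leq_pexp2l.
rewrite queryE !size_cat (size_enc_nat #|A|) (size_enc_nat #|P|) (size_enc_nat #|Q|).
apply: (query_size_arith n0 nn nA nP nQ); rewrite -?E -?E'; auto.
Qed.

(** * The language of the automaton *)

Lemma acceptP q a q' : accept q a q' <->
  exists2 u, (base q, u, base q') \in tI & column tT (word q) a (word q') [set u].
Proof. exact: iter_round_accept (size_query_ge q a q'). Qed.

Lemma A1_run q x : nfa_accepts_from A1 q x -> exists y, run (word q) (base q) x y.
Proof.
elim: x q => [|a x IH] q /=.
  by rewrite inE => /andP[/allP wF pF]; exists [::]; apply: RunNil.
case/existsP=> q' /andP[]; rewrite inE => /acceptP[u tu col] /IH[y r].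
by exists (u :: y); apply: RunCons tu col r.
Qed.

(** A duplicate-free list has at most one entry per state of the transducer, so it fits into the
    slots after padding with the fresh symbol. *)
Lemma A1_state_exists w p : uniq w -> exists q, word q = w /\ base q = p.
Proof.
move=> uw; have sz : size (map Some w ++ nseq (#|Q| - size w) None) == #|Q|.
  rewrite size_cat size_map size_nseq subnKC //.
  by rewrite -(card_uniqP uw) max_card.
have qS : ((Tuple sz, (set0, set0), false, p) : A1_state R) \in A1_set by rewrite inE /= eqxx.
exists (exist (fun q : A1_state R => q \in A1_set) _ qS); split=> //; rewrite /word /slots /=.
rewrite pmap_cat -[RHS]cats0; congr (_ ++ _); first by elim: (w) => //= z s ->.
by elim: (_ - _).
Qed.

(** Every letter of the box is produced by its column, so any [y] in the box can be guessed along
    the chain. *)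
Lemma chain_A1 w x bs y q : chain w x bs -> inbox y bs -> word q = w ->
  nfa_accepts_from (autI R) (base q) y -> nfa_accepts_from A1 q x.
Proof.
move=> ch; elim: ch y q => {w x bs} [w uw wF|w a w' B x bs uw col aB ch IH] [|u y] q //=.
  by move=> _ Ew pF; rewrite inE pF andbT Ew; apply/allP.
case/andP=> uB ybs Ew /existsP[p' /andP[tu ac]].
have uw' : uniq w' by case: ch.
have [q' [Ew' Ep']] := A1_state_exists p' uw'.
apply/existsP; exists q'; rewrite inE /= (IH y) ?Ep' // andbT.
apply/acceptP; exists u; rewrite ?Ep' // Ew Ew' => X Y Z /col[wY w'Z BX]; split=> //.
by rewrite sub1set (subsetP BX).
Qed.

Lemma A1_correct x : nfa_accepts A1 x <-> IndInv1 x.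
Proof.
split.
  case/existsP=> q /andP[]; rewrite inE => /andP[/allP wI pI] /A1_run[y r].
  exists y; split; last exact: run_IndInv r wI.
  by apply/existsP; exists (base q); rewrite pI (run_accepts r).
case=> y [/existsP[p /andP[pI ac]] yx].
(* The box grown around [x] is closed under predecessors, so it must contain the initial
   configuration [y]. *)
have [w [bs [ch wI bc]]] := chain_closed x.
have yB := reach1_inbox yx (chain_inbox ch) bc.
have uw : uniq w by case: ch.
have [q [Ew Ep]] := A1_state_exists p uw.
apply/existsP; exists q; rewrite inE Ew Ep pI andbT (chain_A1 ch yB) ?Ep // andbT.
exact/allP.
Qed.

End Automaton.

Theorem theorem5p11 :
  exists (M : tm) (p : {poly nat}),
  forall R : rts,
  exists (S : {set A1_state R}) (A1 : nfa (letter R) {q : A1_state R | q \in S}),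
    (forall (q q' : {q : A1_state R | q \in S}) (a : letter R),
       tm_decides_within M (enc_query (val q) a (val q')) p.[rts_size R]%R
         ((q, a, q') \in nfa_trans A1))
    /\ (forall w : seq (letter R), nfa_accepts A1 w <-> IndInv1 w).
Proof.
(* The quadratic running time from [main_decides], composed with the quadratic bound [size_query_le]
   on the length of a query. *)
exists main_tm, (200 *: (47 *: 'X^2) ^+ 2)%R => R; exists (A1_set R), (A1 R).
split=> [q q' a|w]; last exact: A1_correct.
rewrite inE.
pose g := pass (nfa_trans (autI R)) (nfa_trans (autT R)) (slots q) (slots q') (base q) (base q') a.
apply: (@main_decides _ _ _ (query q a q') g _ (@consumes_pass R q a q')).
rewrite !(hornerZ, horner_exp, hornerX).
apply: leq_mul => //; rewrite GRing.expr2 -mulnn.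
have le := size_query_le q a q'; rewrite -mulnn in le; rewrite GRing.expr2.
exact: (leq_mul le le).
Qed.
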